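(* Let $\Gamma$ be a Coxeter graph of small type with no triangle, with finite vertex set $S$. There is a choice of polynomials $T(s,\beta)\in\mathbb{Q}[y]$, $s\in S$ and $\beta\in\Phi^+$, such that, with $\psi_s:V\to V$ the linear map defined by $\psi_s(e_\beta)=\varphi_s(e_\beta)+x\,T(s,\beta)\cdot e_{\alpha_s}$ for all $\beta\in\Phi^+$, the mapping $\sigma_s\mapsto\psi_s$, $s\in S$, induces a homomorphism $\psi:G_\Gamma^+\to \mathrm{Gl}(V)$.
   Context: A Coxeter graph $\Gamma$ encodes a Coxeter matrix $(m_{s,t})_{s,t\in S}$ over a finite set $S$ ($m_{s,s}=1$, $m_{s,t}=m_{t,s}\in\{2,3,\dots,+\infty\}$ for $s\ne t$). $\Gamma$ is of small type if $m_{s,t}\in\{2,3\}$ for all $s\neq t$; it has no triangle if there is no triple $\{s,t,r\}$ in $S$ with $m_{s,t},m_{s,r},m_{t,r}\ge 3$. The Artin monoid $G_\Gamma^+$ is the monoid presented by generators $\sigma_s$ ($s\in S$) and, in the small type case, relations $\sigma_s\sigma_t=\sigma_t\sigma_s$ if $m_{s,t}=2$ and $\sigma_s\sigma_t\sigma_s=\sigma_t\sigma_s\sigma_t$ if $m_{s,t}=3$. Root system: let $U$ be the real vector space with basis $\Pi=\{\alpha_s;s\in S\}$ and $\langle\ ,\ \rangle$ the symmetric bilinear form with $\langle\alpha_s,\alpha_t\rangle=-2\cos(\pi/m_{s,t})$ (so it is $2$ if $s=t$, $0$ if $m_{s,t}=2$, $-1$ if $m_{s,t}=3$). The Coxeter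 group $W=\langle S\mid s^2=1,\ (st)^{m_{s,t}}=1\rangle$ acts on $U$ by $s(u)=u-\langle\alpha_s,u\rangle\alpha_s$. The root system is $\Phi=\{w\alpha_s;s\in S,w\in W\}$ and $\Phi^+$ is the set of roots that are nonnegative combinations of the $\alpha_s$. For small type, $\langle\beta,\gamma\rangle\in\mathbb{Z}$ for all roots $\beta,\gamma$. Let $\mathbb{K}=\mathbb{Q}(x,y)$ be the field of rational functions in two variables, and $V$ the $\mathbb{K}$-vector space with basis $\{e_\beta;\beta\in\Phi^+\}$. For $s\in S$ the linear map $\varphi_s:V\to V$ is defined by $$\varphi_s(e_\beta)=\begin{cases}0&\text{if }\beta=\alpha_s\\ e_\beta&\text{if }\langle\alpha_s,\beta\rangle=0\\ y\cdot e_{\beta-a\alpha_s}&\text{if }\langle\alpha_s,\beta\rangle=a>0,\ \beta\ne\alpha_s\\ (1-y)\cdot e_\beta+e_{\beta+a\alpha_s}&\text{if }\langle\alpha_s,\beta\rangle=-a<0.\end{cases}$$ *)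

(* Defs.v *)
From HB Require Import structures.
From mathcomp Require Import all_boot all_order all_algebra.
From mathcomp Require Import generic_quotient.
From mathcomp Require Import freeg.
From mathcomp Require Import boolp reals trigo.

Set Implicit Arguments.
Unset Strict Implicit.
Unset Printing Implicit Defensive.

Import Order.TTheory GRing.Theory Num.Theory.
Local Open Scope ring_scope.
Local Open Scope quotient_scope.

Section PresentedMonoid.
Variables (X : choiceType) (r : seq X -> seq X -> Prop).

Inductive pres_cong : seq X -> seq X -> Prop :=
| PresRel u v : r u v -> pres_cong u v
| PresRefl u : pres_cong u u
| PresSym u v : pres_cong u v -> pres_cong v u
| PresTrans v u w : pres_cong u v -> pres_cong v w -> pres_cong u w
| PresCat u u' v v' :
    pres_cong u u' -> pres_cong v v' -> pres_cong (u ++ v) (u' ++ v').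

Definition pres_rel : rel (seq X) := fun u v => `[< pres_cong u v >].

Lemma pres_rel_refl : reflexive pres_rel.
Proof. by move=> u; apply/asboolP; apply: PresRefl. Qed.

Lemma pres_rel_sym : symmetric pres_rel.
Proof. by move=> u v; apply/asboolP/asboolP; apply: PresSym. Qed.

Lemma pres_rel_trans : transitive pres_rel.
Proof.
by move=> v u w /asboolP uv /asboolP vw; apply/asboolP; apply: PresTrans uv vw.
Qed.

Canonical pres_equiv : equiv_rel (seq X) :=
  EquivRel pres_rel pres_rel_refl pres_rel_sym pres_rel_trans.

(* The monoid < X | u = v for r u v >: the words in X, modulo the congruence
   generated by r. *)
Definition presented := {eq_quot pres_equiv}.

HB.instance Definition _ := Choice.on presented.
HB.instance Definition _ := Quotient.on presented.
HB.instance Definition _ : EqQuotient _ pres_equiv presented :=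
  EqQuotient.on presented.

Definition pres_word (u : seq X) : presented := \pi u.
Definition pres_one : presented := pres_word [::].
Definition pres_mul (a b : presented) : presented :=
  pres_word (repr a ++ repr b).

Lemma pres_wordP u v : pres_word u = pres_word v <-> pres_cong u v.
Proof. by split=> [/eqmodP/asboolP|uv] //; apply/eqmodP/asboolP. Qed.

Lemma pres_word_repr a : pres_word (repr a) = a.
Proof. exact: reprK. Qed.

Lemma pres_word_cat u v : pres_word (u ++ v) = pres_mul (pres_word u) (pres_word v).
Proof.
by apply/pres_wordP/PresCat; apply/pres_wordP; rewrite pres_word_repr.
Qed.

Fact pres_mulA : associative pres_mul.
Proof.
move=> a b c; rewrite -[a]pres_word_repr -[b]pres_word_repr -[c]pres_word_repr.
by rewrite -!pres_word_cat catA.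
Qed.

Fact pres_mul1 : left_id pres_one pres_mul.
Proof. by move=> a; rewrite -[a]pres_word_repr -pres_word_cat. Qed.

Fact pres_mulr1 : right_id pres_one pres_mul.
Proof. by move=> a; rewrite -[a]pres_word_repr -pres_word_cat cats0. Qed.

HB.instance Definition _ := isMonoid.Build presented pres_mulA pres_mul1 pres_mulr1.

End PresentedMonoid.

Section GeneralLinear.
Variables (K : fieldType) (V : lmodType K).

Record general_linear := GeneralLinear {
  gl_fun :> V -> V;
  gl_linear : linear gl_fun;
  gl_bij : bijective gl_fun
}.

HB.instance Definition _ (f : general_linear) :=
  GRing.isLinear.Build K V V _ (gl_fun f) (gl_linear f).

HB.instance Definition _ := gen_eqMixin general_linear.
HB.instance Definition _ := gen_choiceMixin general_linear.

Lemma gl_ext (f g : general_linear) : f =1 g -> f = g.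
Proof.
case: f g => [f fl fb] [g gl gb] /= /funext fg; subst g.
by congr GeneralLinear; apply: Prop_irrelevance.
Qed.

Definition gl_one : general_linear :=
  @GeneralLinear idfun (fun _ _ _ => erefl) (Bijective (frefl _) (frefl _)).

Fact gl_mul_linear (f g : general_linear) : linear (f \o g).
Proof. by move=> a u v; rewrite /= !linearP. Qed.

Definition gl_mul (f g : general_linear) : general_linear :=
  GeneralLinear (@gl_mul_linear f g) (bij_comp (gl_bij f) (gl_bij g)).

Fact gl_inv_ex (f : general_linear) : exists g, cancel f g /\ cancel g f.
Proof. by have [g fK gK] := gl_bij f; exists g. Qed.

Definition gl_inv_fun (f : general_linear) : V -> V := sval (cid (gl_inv_ex f)).

Lemma gl_funK (f : general_linear) : cancel f (gl_inv_fun f).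
Proof. exact: (svalP (cid (gl_inv_ex f))).1. Qed.

Lemma gl_inv_funK (f : general_linear) : cancel (gl_inv_fun f) f.
Proof. exact: (svalP (cid (gl_inv_ex f))).2. Qed.

Fact gl_inv_linear (f : general_linear) : linear (gl_inv_fun f).
Proof.
by move=> a u v; apply: (can_inj (gl_funK f)); rewrite gl_linear !gl_inv_funK.
Qed.

Definition gl_inv (f : general_linear) : general_linear :=
  GeneralLinear (@gl_inv_linear f)
    (Bijective (gl_inv_funK f) (gl_funK f)).

Fact gl_mulA : associative gl_mul.
Proof. by move=> f g h; apply: gl_ext. Qed.

Fact gl_mul1 : left_id gl_one gl_mul.
Proof. by move=> f; apply: gl_ext. Qed.

Fact gl_mulr1 : right_id gl_one gl_mul.
Proof. by move=> f; apply: gl_ext. Qed.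

Fact gl_mulV : left_inverse gl_one gl_inv gl_mul.
Proof. by move=> f; apply: gl_ext => v; apply: gl_funK. Qed.

Fact gl_mulrV : right_inverse gl_one gl_inv gl_mul.
Proof. by move=> f; apply: gl_ext => v; apply: gl_inv_funK. Qed.

HB.instance Definition _ := isGroup.Build general_linear
  gl_mulA gl_mul1 gl_mulr1 gl_mulV gl_mulrV.

End GeneralLinear.

Section LinearExtension.
Variables (K : fieldType) (I : choiceType) (V : lmodType K) (f : I -> V).

Definition linear_extension (v : {freeg I / K}) : V := fglift f v.

Lemma linear_extension_basis i : linear_extension << i >> = f i.
Proof. by rewrite /linear_extension liftU scale1r. Qed.

Fact linear_extension_linear : linear linear_extension.
Proof.
have ladd : {morph linear_extension : u v / u + v}.
  have lsub : {morph linear_extension : u v / u - v}.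
    exact: lift_is_additive.
  have l0 : linear_extension 0 = 0 by rewrite -(subrr 0) lsub subrr.
  by move=> u v; rewrite -{1}[v]opprK lsub -[- v]add0r lsub l0 add0r opprK.
have lU c i : linear_extension << c *g i >> = c *: f i by exact: liftU.
move=> a u v; rewrite ladd; congr (_ + _); rewrite -{2}[u]freeg_sumE.
rewrite [a *: u]/(fgscale a u) /fgscale; elim: (dom u) => [|i s IH].
  rewrite !big_nil; suff -> : linear_extension 0 = 0 by rewrite scaler0.
  by apply: (addIr (linear_extension 0)); rewrite -ladd !add0r.
by rewrite !big_cons !ladd IH !lU scalerDr scalerA.
Qed.

HB.instance Definition _ := GRing.isLinear.Build K {freeg I / K} V _
  linear_extension linear_extension_linear.

End LinearExtension.

(* [None] stands for m_{s,t} = +oo. *)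
Record coxeter_matrix (S : finType) := CoxeterMatrix {
  cox_entry :> S -> S -> option nat;
  cox_diag : forall s, cox_entry s s = Some 1%N;
  cox_sym : forall s t, cox_entry s t = cox_entry t s;
  cox_offdiag : forall s t k, s != t -> cox_entry s t = Some k -> (2 <= k)%N
}.

Section CoxeterGraph.
Variables (S : finType) (M : coxeter_matrix S).

Definition small_type : Prop :=
  forall s t, s != t -> M s t = Some 2%N \/ M s t = Some 3%N.

Definition cox_edge (s t : S) : bool :=
  if M s t is Some k then (3 <= k)%N else true.

(* As m_{s,s} = 1, the three vertices are automatically distinct. *)
Definition no_triangle : Prop :=
  ~ exists s t r, [/\ cox_edge s t, cox_edge s r & cox_edge t r].

(* The defining relations as given for small type, where these are the only
   values of m_{s,t} with s != t. *)
Inductive artin_rel : seq S -> seq S -> Prop :=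
| ArtinComm s t : M s t = Some 2%N -> artin_rel [:: s; t] [:: t; s]
| ArtinBraid s t : M s t = Some 3%N -> artin_rel [:: s; t; s] [:: t; s; t].

Definition artin_monoid := presented artin_rel.

HB.instance Definition _ := monoid.Monoid.on artin_monoid.

Definition artin_gen (s : S) : artin_monoid := pres_word artin_rel [:: s].

End CoxeterGraph.

Section RootSystem.
Variables (R : realType) (S : finType) (M : coxeter_matrix S).

(* U, in coordinates with respect to the basis Pi. *)
Definition root_space := {ffun S -> R^o}.

HB.instance Definition _ := GRing.Lmodule.on root_space.

Definition simple_root (s : S) : root_space := [ffun t => (t == s)%:R].

Definition cox_gram (s t : S) : R :=
  if M s t is Some k then - 2 * cos (pi / k%:R) else - 2.

Definition cox_form (u v : root_space) : R :=
  \sum_(s : S) \sum_(t : S) (u s : R) * (v t : R) * cox_gram s t.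

Definition cox_refl (s : S) (u : root_space) : root_space :=
  u - cox_form (simple_root s) u *: simple_root s.

(* Elements of the Coxeter group W are represented by words in S: as s^2 = 1,
   every element of W is a product of generators. *)
Definition cox_act (w : seq S) (u : root_space) : root_space :=
  foldr cox_refl u w.

Definition is_root (u : root_space) : Prop :=
  exists w s, u = cox_act w (simple_root s).

Definition is_pos_root (u : root_space) : Prop :=
  is_root u /\ forall s, 0 <= (u s : R).

Record pos_root := PosRoot {
  root_val :> root_space;
  _ : `[< is_pos_root root_val >]
}.

HB.instance Definition _ := [isSub for root_val].
HB.instance Definition _ := [Choice of pos_root by <:].

Lemma simple_root_pos s : is_pos_root (simple_root s).
Proof. by split=> [|t]; [exists [::], s | rewrite ffunE ler0n]. Qed.

Definition simple_pos_root (s : S) : pos_root :=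
  PosRoot (asboolT (simple_root_pos s)).

End RootSystem.

(* Q(x,y), as the field of fractions of Q[y][x]. *)
Definition ratfun2 := {fraction {poly {poly rat}}}.

HB.instance Definition _ := GRing.Field.on ratfun2.

Definition ratfun_x : ratfun2 := tofrac 'X.
Definition ratfun_of_y (p : {poly rat}) : ratfun2 := tofrac p%:P.
Definition ratfun_y : ratfun2 := ratfun_of_y 'X.

Section Representation.
Variables (R : realType) (S : finType) (M : coxeter_matrix S).

Definition root_module := {freeg (pos_root R M) / ratfun2}.

HB.instance Definition _ := GRing.Lmodule.on root_module.

(* e_u for u in Phi^+.  The value 0 outside Phi^+ is never relevant: below, u
   is beta or s(beta) with beta != alpha_s in Phi^+, which is again in Phi^+. *)
Definition root_basis (u : root_space R S) : root_module :=
  if insub u is Some b then << b >> else 0.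

Lemma root_basisE (b : pos_root R M) : root_basis (root_val b) = << b >>.
Proof. by rewrite /root_basis valK. Qed.

(* a is the signed value of <alpha_s, beta>. *)
Definition phi_basis (s : S) (b : pos_root R M) : root_module :=
  let alpha := simple_root R s in
  let a := cox_form M alpha b in
  if root_val b == alpha then 0
  else if a == 0 then root_basis b
  else if 0 < a then ratfun_y *: root_basis (root_val b - a *: alpha)
  else (1 - ratfun_y) *: root_basis b + root_basis (root_val b + (- a) *: alpha).

Definition phi (s : S) : root_module -> root_module :=
  linear_extension (phi_basis s).

Definition psi (T : S -> pos_root R M -> {poly rat}) (s : S) :
    root_module -> root_module :=
  linear_extension (fun b : pos_root R M => phi s (root_basis b)
    + (ratfun_x * ratfun_of_y (T s b)) *: root_basis (simple_root R s)).

End Representation.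

(* Main.v *)
Require Import Defs.
From HB Require Import structures.
From mathcomp Require Import all_boot all_order all_algebra reals.
From mathcomp Require Import freeg boolp trigo ring lra.

(* Writing psi_s = phi_s + x T_s(-) e_{alpha_s} for a linear form T_s with values
   in Q[y], the Artin relations for the psi_s reduce to T_s(e_{alpha_t}) = 0 for
   s <> t, to T_s phi_t = T_s when m_{s,t} = 2 and to T_s phi_t = T_t phi_s when
   m_{s,t} = 3.  With d the depth of a positive root (0 for a simple root), put
     T_s(e_b) = (y - 1) (y^d - N_s(b)) + [b = alpha_s].
   Then N_s(b) = 0 when <alpha_s, b> > 0, N_s(alpha_t) = 1 when t <> s, and
   otherwise N_s(b) is determined by the roots below t b for any t with
   <alpha_t, b> > 0.  Two such t, r give the same value: one compares them by
   going down to the bottom of the orbit of b under <t, r>, which together with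
   s is a computation in rank 3; as the graph has no triangle, only the finite
   types A1 x A1 x A1, A2 x A1 and A3 occur. *)

Set Implicit Arguments.
Unset Strict Implicit.
Unset Printing Implicit Defensive.

Import Order.TTheory GRing.Theory Num.Theory.

(** The linear form sending [e_b] to [y^d] is fixed by [phi_t] on every [e_b] with [b] different
    from [alpha_t]: its value there is [y * y^(d-1)], [y^d] or [(1 - y) y^d + y^(d+1)], according to
    the sign of the pairing. Away from the simple roots it thus meets all the conditions on the
    forms at once. Subtracting it leaves homogeneous rules for [N_s]. The values at simple roots
    make [T_s] vanish on [e_{alpha_t}] and equal [y] on [e_{alpha_s}]; the edge condition at
    [e_{alpha_s}] then demands [(y - 1) y] on [alpha_s + alpha_t], whence the factor [y - 1]. The
    value [y] also gives invertibility: [phi_s] kills [e_{alpha_s}], but [psi_s] has it as an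
    eigenvector for [x y], which is nonzero.

    Each condition ties together the roots of one rank two orbit, whereas a root may be at the top
    of several of them. The rules are therefore stated going up from a lower root, and their
    compatibility is the main point. It rests only on the numbers [<alpha_s, b>], the Coxeter
    relations and the fact that, away from [alpha_s], a positive pairing with [alpha_s] means that
    [s] lowers the depth by one. *)

Section PresentedLift.
Variables (X : choiceType) (r : seq X -> seq X -> Prop) (G : monoidType) (h : X -> G).
Local Open Scope group_scope.

Definition word_eval (w : seq X) : G := foldr (fun x a => h x * a) 1 w.

Lemma word_eval_cat u v : word_eval (u ++ v) = word_eval u * word_eval v.
Proof. by elim: u => [|x u IH] /=; rewrite ?mul1g // IH mulgA. Qed.

Hypothesis relh : forall u v, r u v -> word_eval u = word_eval v.

Lemma word_eval_cong u v : pres_cong r u v -> word_eval u = word_eval v.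
Proof.
elim=> [{}u {}v /relh //|//|{}u {}v _ ->//|{}v {}u w _ -> _ ->//|].
by move=> {}u u' {}v v' _ IHu _ IHv; rewrite !word_eval_cat IHu IHv.
Qed.

Definition pres_lift (a : presented r) : G := word_eval (generic_quotient.repr a).

Lemma pres_lift_word w : pres_lift (pres_word r w) = word_eval w.
Proof. by apply: word_eval_cong; apply/pres_wordP; rewrite pres_word_repr. Qed.

Lemma pres_lift_morphism : monoid.monoid_morphism pres_lift.
Proof.
split; first exact: (pres_lift_word [::]).
move=> a b; rewrite -[a]pres_word_repr -[b]pres_word_repr.
by rewrite -[_ * _]/(pres_mul _ _) -pres_word_cat !pres_lift_word word_eval_cat.
Qed.

Lemma presented_universal : exists f : UMagmaMorphism.type (presented r) G,
  forall x, f (pres_word r [:: x]) = h x.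
Proof.
pose f : UMagmaMorphism.type (presented r) G :=
  HB.pack pres_lift (monoid.isUMagmaMorphism.Build _ _ pres_lift pres_lift_morphism).
by exists f => x; rewrite [LHS]pres_lift_word /= mulg1.
Qed.

End PresentedLift.

Local Open Scope ring_scope.

(** * The polynomials N_s(b) *)

Section ReflectionCoefficients.
Variables (R : realFieldType) (S : finType) (X : eqType).
Variables (adj : rel S) (g : S -> S -> R).
Variables (alpha : S -> X) (refl : S -> X -> X) (pair : S -> X -> R).
Variable depth_root : nat -> X -> Prop.

Hypothesis edge_sym : symmetric adj.
Hypothesis edge_neq : forall s t, adj s t -> s != t.
Hypothesis no_tri : forall r s t, adj r s -> adj r t -> adj s t -> False.
Hypothesis gram_diag : forall s, g s s = 2.
Hypothesis gram_edge : forall s t, adj s t -> g s t = -1.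
Hypothesis gram_nonedge : forall s t, s != t -> ~~ adj s t -> g s t = 0.
Hypothesis pair_simple : forall s t, pair s (alpha t) = g s t.
Hypothesis pair_refl :
  forall s t u, pair s (refl t u) = pair s u - pair t u * g s t.
Hypothesis reflK : forall s, involutive (refl s).
Hypothesis refl_comm : forall s t u, s != t -> ~~ adj s t ->
  refl s (refl t u) = refl t (refl s u).
Hypothesis refl_braid : forall s t u, adj s t ->
  refl s (refl t (refl s u)) = refl t (refl s (refl t u)).
Hypothesis refl_simple_edge : forall s t, adj s t ->
  refl s (alpha t) = refl t (alpha s).
Hypothesis depth_refl : forall n t u,
  depth_root n u -> pair t u < 0 -> depth_root n.+1 (refl t u).
Hypothesis depth_simple : forall n s, depth_root n (alpha s) -> n = 0%N.
Hypothesis depth_case : forall n u, depth_root n u ->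
  (exists s, u = alpha s) \/
  exists m t v, [/\ n = m.+1, u = refl t v, depth_root m v & pair t v < 0].
Hypothesis descent : forall n s u, depth_root n u -> u != alpha s ->
  0 < pair s u -> exists2 m, n = m.+1 & depth_root m (refl s u).

(* [lra] is very slow in the presence of the hypotheses cleared here. *)
Ltac real_lra :=
  repeat match goal with
  | H : is_true (adj _ _) |- _ => clear H
  | H : is_true (~~ _) |- _ => clear H
  | H : depth_root _ _ |- _ => clear H
  | H : @eq X _ _ |- _ => clear H
  | H : @eq nat _ _ |- _ => clear H
  | H : @eq {poly rat} _ _ |- _ => clear H
  | H := _ |- _ => clearbody H
  end; lra.

Local Notation poly := {poly rat}.

Lemma gram_neq s t : s != t -> g s t = - (adj s t)%:R.
Proof.
move=> st; case: (boolP (adj s t)) => e; first exact: gram_edge.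
by rewrite gram_nonedge // oppr0.
Qed.

(* N_s(t u) for <alpha_t, u> < 0, where [f] gives the values at the depth of [u]
   and [h] those one step below. *)
Definition coef_step (f h : X -> S -> poly) (u : X) (s t : S) : poly :=
  if 0 < pair s (refl t u) then 0
  else if ~~ adj s t then 'X * f u s
  else if pair s u < 0 then 'X * f u s + f u t
  else if pair s u == 0 then ('X - 1) * f u s + f u t
  else 'X * h (refl s u) t.

(* N_s(u) for a root [u] of depth [n]; the choice of [t] does not matter by
   [coef_upward]. *)
Fixpoint coef (n : nat) (u : X) (s : S) {struct n} : poly :=
  if n is m.+1 then
    if [pick t | 0 < pair t u] is Some t then
      coef_step (coef m) (coef m.-1) (refl t u) s t
    else 0
  else if 0 < pair s u then 0 else 1.

(** * The recursion along one upward reflection *)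

Section Step.
Variables (f h : X -> S -> poly) (u : X) (s t : S).

Lemma coef_step_nonedge : s != t -> ~~ adj s t -> (0 < pair s u -> f u s = 0) ->
  coef_step f h u s t = 'X * f u s.
Proof.
move=> st e fu; rewrite /coef_step e pair_refl gram_nonedge // mulr0 subr0.
by case: ifP => // /fu ->; rewrite mulr0.
Qed.

(** A choice: the edge condition fixes only the difference of [T_s(e_{t u})] and [T_t(e_{s u})], and
    within the orbit only at [e_u]. With this value, and up to the factor [y - 1], either side at
    [e_u] is [y^n - N_s(u) - N_t(u)], which is symmetric in [s] and [t]. *)
Lemma coef_step_lt0 : adj s t -> pair t u < 0 -> pair s u < 0 ->
  coef_step f h u s t = 'X * f u s + f u t.
Proof.
move=> e tu su; rewrite /coef_step e su pair_refl gram_edge //.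
by case: ifP => // pos; exfalso; real_lra.
Qed.

(** Forced: [s] fixes [u], so the edge condition at [e_u] reads [(1 - y) T_s(e_u) + T_s(e_{t u}) =
    T_t(e_u)]. *)
Lemma coef_step_eq0 : adj s t -> pair t u < 0 -> pair s u = 0 ->
  coef_step f h u s t = ('X - 1) * f u s + f u t.
Proof.
move=> e tu su; rewrite /coef_step e pair_refl gram_edge // su eqxx ltxx.
by case: ifP => // pos; exfalso; real_lra.
Qed.

(** Forced: the edge condition at [e_u] is [(1 - y) T_s(e_u) + T_s(e_{t u}) = y T_t(e_{s u})], where
    [N_s(u) = 0]. The bound on the sum says that [<alpha_s, t u>] is not positive. *)
Lemma coef_step_gt0 : adj s t -> 0 < pair s u -> pair s u + pair t u <= 0 ->
  coef_step f h u s t = 'X * h (refl s u) t.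
Proof.
move=> e su stu; rewrite /coef_step e pair_refl gram_edge //.
rewrite (gt_eqF su) [pair s u < 0]ltNge (ltW su) /=.
by case: ifP => // pos; exfalso; real_lra.
Qed.

End Step.

Lemma coef_gt0 n u s : 0 < pair s u -> coef n u s = 0.
Proof.
move=> su; case: n => [|n] /=; first by rewrite su.
by case: pickP => // t tu; rewrite /coef_step reflK su.
Qed.

Lemma coef_simple s t : s != t -> coef 0 (alpha t) s = 1.
Proof.
by move=> st /=; rewrite pair_simple gram_neq // oppr_gt0 ltNge ler0n.
Qed.

Lemma coefS n u s : coef n.+1 u s =
  if [pick t | 0 < pair t u] is Some t then
    coef_step (coef n) (coef n.-1) (refl t u) s t
  else 0.
Proof. by []. Qed.

Arguments coef : simpl never.

(** The truncation [0.-1 = 0] is harmless: at [n = 0] the last rule would need [u = alpha s] with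
    [s] and [t] adjacent, and then [<alpha_s, t u> = 1] has already given the value 0. *)
Definition upward n := forall u t s, depth_root n u -> pair t u < 0 -> s != t ->
  coef n.+1 (refl t u) s = coef_step (coef n) (coef n.-1) u s t.

Section Upward.
Variables (n : nat) (u : X) (s t : S).
Hypotheses (up : upward n) (du : depth_root n u) (tu : pair t u < 0).

Lemma up_nonedge : s != t -> ~~ adj s t -> coef n.+1 (refl t u) s = 'X * coef n u s.
Proof. by move=> st e; rewrite up // coef_step_nonedge // => /coef_gt0. Qed.

Lemma up_lt0 : adj s t -> pair s u < 0 ->
  coef n.+1 (refl t u) s = 'X * coef n u s + coef n u t.
Proof. by move=> e su; rewrite up ?(edge_neq e) // coef_step_lt0. Qed.

Lemma up_eq0 : adj s t -> pair s u = 0 ->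
  coef n.+1 (refl t u) s = ('X - 1) * coef n u s + coef n u t.
Proof. by move=> e su; rewrite up ?(edge_neq e) // coef_step_eq0. Qed.

Lemma up_gt0 : adj s t -> 0 < pair s u -> pair s u + pair t u <= 0 ->
  coef n.+1 (refl t u) s = 'X * coef n.-1 (refl s u) t.
Proof. by move=> e su stu; rewrite up ?(edge_neq e) // coef_step_gt0. Qed.

End Upward.

Lemma neq_simple s t u : pair s u != g s t -> u != alpha t.
Proof. by apply: contra_neq => ->; rewrite pair_simple. Qed.

(* [r] and [t] commute and [u] is the bottom of the square
   [u, r u, t u, r t u], with [s] adjacent to both. *)
Lemma coef_square_star n r s t u :
  (forall m, (m <= n)%N -> upward m) -> depth_root n u ->
  r != t -> ~~ adj r t -> adj s r -> adj s t ->
  pair r u < 0 -> pair t u < 0 -> pair s u + pair r u + pair t u <= 0 ->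
  coef_step (coef n.+1) (coef n) (refl r u) s t =
  coef_step (coef n.+1) (coef n) (refl t u) s r.
Proof.
move=> up du rt nrt esr est ru tu top.
(* The claim is symmetric in [r] and [t]; ordering the two pairings discards the sign patterns in
   which only [<alpha_s, t u>] is the larger one. *)
wlog tru : r t rt nrt esr est ru tu top / pair t u <= pair r u.
  move=> wl; have [tru|/ltW rtu] := lerP (pair t u) (pair r u); first exact: wl.
  by symmetry; apply: wl => //; rewrite 1?eq_sym 1?edge_sym // addrAC.
have tr : t != r by rewrite eq_sym.
have ntr : ~~ adj t r by rewrite edge_sym.
have ers : adj r s by rewrite edge_sym.
have ets : adj t s by rewrite edge_sym.
pose gE := (gram_nonedge rt nrt, gram_nonedge tr ntr, gram_edge ers, gram_edge ets,
  gram_edge esr, gram_edge est, gram_diag r, gram_diag s, gram_diag t).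
have upn := up n (leqnn n).
have psr : pair s (refl r u) = pair s u + pair r u by rewrite pair_refl !gE; real_lra.
have pst : pair s (refl t u) = pair s u + pair t u by rewrite pair_refl !gE; real_lra.
have ptr : pair t (refl r u) = pair t u by rewrite pair_refl !gE; real_lra.
have prt : pair r (refl t u) = pair r u by rewrite pair_refl !gE; real_lra.
have crt : coef n.+1 (refl r u) t = 'X * coef n u t by rewrite up_nonedge.
have ctr : coef n.+1 (refl t u) r = 'X * coef n u r by rewrite up_nonedge.
have [su|su|su] := ltrgt0P (pair s u); last 2 first.
- rewrite !coef_step_lt0 ?psr ?pst ?ptr ?prt //; [|real_lra..].
  by rewrite crt ctr !(up_lt0 upn) //; ring.
- rewrite !coef_step_lt0 ?psr ?pst ?ptr ?prt //; [|real_lra..].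
  by rewrite crt ctr !(up_eq0 upn) //; ring.
(* Here no root lies below [u] along [s]. As [s r alpha_s = alpha_r] and [s t alpha_s = alpha_t],
   both sides are ['X] times a value 1 at a simple root. *)
have [us|us] := eqVneq u (alpha s).
  have n0 : n = 0%N by move: du; rewrite us; apply: depth_simple.
  have sn q : adj s q -> refl s (refl q u) = alpha q.
    by move=> sq; rewrite us -refl_simple_edge // reflK.
  move: su ru tu psr pst; rewrite us !pair_simple !gE => _ _ _ psr pst.
  rewrite -us in psr pst *.
  rewrite !coef_step_gt0 ?psr ?pst ?ptr ?prt ?us ?pair_simple ?gE //; [|real_lra..].
  by rewrite -us !sn // n0 !coef_simple.
have [k nk dv] := descent du us su; set v := refl s u in dv.
have uv : u = refl s v by rewrite reflK.
have psv : pair s v = - pair s u by rewrite pair_refl !gE; real_lra.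
have prv : pair r v = pair s u + pair r u by rewrite pair_refl !gE; real_lra.
have ptv : pair t v = pair s u + pair t u by rewrite pair_refl !gE; real_lra.
have upk : upward k by apply: up; rewrite nk.
(* If [q] lowers [v] as well, the braid relation gives [s q u = s q s v = q s (q v)], and since [q]
   and [q'] commute, the outer [q] only contributes a factor ['X]. *)
have gt_case q q' : adj s q -> adj s q' -> q != q' -> ~~ adj q q' ->
    pair q u < 0 -> 0 < pair s u + pair q u ->
    exists j, [/\ k = j.+1, depth_root j (refl q v), upward j &
      coef n (refl s (refl q u)) q' = 'X * coef k (refl s (refl q v)) q' ].
  move=> esq esq' qq' nqq' qu squ.
  have eqs : adj q s by rewrite edge_sym.
  have gsq := gram_edge esq; have gqs := gram_edge eqs.
  have pqv : pair q v = pair s u + pair q u by rewrite pair_refl gqs; real_lra.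
  have vq : v != alpha q.
    apply/negP => /eqP e; move: psv pqv.
    by rewrite e !pair_simple gsq gram_diag; real_lra.
  have [|j kj dj] := descent dv vq; first by rewrite pqv.
  exists j; split=> //; first by apply: up; rewrite nk kj leqW // leqnSn.
  rewrite uv -refl_braid // nk up_nonedge // 1?eq_sym 1?edge_sym //.
    rewrite kj; apply: depth_refl => //.
    by rewrite pair_refl gsq psv pqv; real_lra.
  by rewrite (pair_refl q s) !(pair_refl _ q v) gsq gqs gram_diag psv pqv; real_lra.
have cs q : adj s q -> pair q u < 0 -> pair s u + pair q u <= 0 ->
    coef n.+1 (refl q u) s = 'X * coef k v q.
  by move=> sq qu squ; rewrite (up_gt0 upn) // nk.
have cn_lt q : adj q s -> pair q v < 0 -> coef n u q = 'X * coef k v q + coef k v s.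
  by move=> qs qv; rewrite nk uv up_lt0 // psv; real_lra.
have cn_eq q : adj q s -> pair q v = 0 ->
    coef n u q = ('X - 1) * coef k v q + coef k v s.
  by move=> qs qv; rewrite nk uv up_eq0 // psv; real_lra.
have [sru|sru|sru] := ltrgt0P (pair s u + pair r u); last 2 first.
- rewrite !coef_step_lt0 ?psr ?pst ?ptr ?prt //; [|real_lra..].
  rewrite !cs ?crt ?ctr //; [|real_lra..].
  by rewrite !cn_lt ?prv ?ptv //; [ring | real_lra].
- rewrite coef_step_eq0 ?psr ?ptr // cs ?crt //; last by real_lra.
  have [stu|stu|stu] := ltrgt0P (pair s u + pair t u); first by exfalso; real_lra.
    rewrite coef_step_lt0 ?pst ?prt // cs ?ctr //; last by real_lra.
    by rewrite cn_lt ?ptv // [coef n u r]cn_eq ?prv //; ring.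
  rewrite coef_step_eq0 ?pst ?prt // cs ?ctr //; last by real_lra.
  by rewrite !cn_eq ?prv ?ptv //; ring.
have [j [kj dj upj ej]] := gt_case r t esr est rt nrt ru sru.
set w := refl r v in dj ej; have vw : v = refl r w by rewrite reflK.
have prw : pair r w = - (pair s u + pair r u) by rewrite pair_refl !gE prv; real_lra.
have psw : pair s w = pair r u by rewrite pair_refl !gE prv psv; real_lra.
have ptw : pair t w = pair s u + pair t u by rewrite pair_refl !gE prv ptv; real_lra.
have ckr : coef n u r = 'X * coef j w s.
  by rewrite nk uv up_gt0 ?prv ?psv //; [rewrite kj | real_lra..].
have ckt : coef k v t = 'X * coef j w t.
  by rewrite kj vw up_nonedge // prw; real_lra.
rewrite coef_step_gt0 ?psr ?ptr //.
rewrite {}ej [in LHS]kj.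
have [stu|stu|stu] := ltrgt0P (pair s u + pair t u); last 2 first.
- rewrite coef_step_lt0 ?pst ?prt // cs ?ctr //; last by real_lra.
  by rewrite ckt ckr up_lt0 ?psw ?ptw //; ring.
- rewrite coef_step_eq0 ?pst ?prt // cs ?ctr //; last by real_lra.
  by rewrite ckt ckr up_eq0 ?psw ?ptw //; ring.
have [i [ki di upi ei]] := gt_case t r est esr tr ntr tu stu.
rewrite coef_step_gt0 ?pst ?prt //; last by real_lra.
set w' := refl t v in di ei; have vw' : v = refl t w' by rewrite reflK.
have ptw' : pair t w' = - (pair s u + pair t u) by rewrite pair_refl !gE ptv; real_lra.
have psw' : pair s w' = pair t u by rewrite pair_refl !gE ptv psv; real_lra.
have prw' : pair r w' = pair s u + pair r u by rewrite pair_refl !gE prv ptv; real_lra.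
(* Both sides have come down to values at [t r v] and [r t v], which are the same root. *)
rewrite {}ei [in RHS]ki !up_gt0 ?psw ?ptw ?psw' ?prw' //; [|real_lra..].
have -> : i = j by apply: succn_inj; rewrite -ki -kj.
by rewrite /w /w' refl_comm.
Qed.

(* [r] and [t] commute and [u] is the bottom of the square
   [u, r u, t u, r t u]. *)
Lemma coef_square n r s t u :
  (forall m, (m <= n)%N -> upward m) -> depth_root n u ->
  r != t -> ~~ adj r t -> s != r -> s != t ->
  pair r u < 0 -> pair t u < 0 -> pair s (refl t (refl r u)) <= 0 ->
  coef_step (coef n.+1) (coef n) (refl r u) s t =
  coef_step (coef n.+1) (coef n) (refl t u) s r.
Proof.
move=> up du rt nrt.
have tr : t != r by rewrite eq_sym.
have ntr : ~~ adj t r by rewrite edge_sym.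
have grt := gram_nonedge rt nrt; have gtr := gram_nonedge tr ntr.
have grr := gram_diag r; have gtt := gram_diag t; have gss := gram_diag s.
have upn := up n (leqnn n).
(* By symmetry [s] is adjacent to neither, to both, or to [t] alone: types A1 x A1 x A1, A3 with [s]
   in the middle, and A2 x A1. *)
wlog: r t rt tr nrt ntr grt gtr grr gtt / adj s r -> adj s t.
  move=> wl sr st ru tu top; case: (boolP (adj s r)) => [esr|nsr]; last first.
    by apply: wl => // /(negP nsr).
  case: (boolP (adj s t)) => [est|nst]; first by apply: wl.
  symmetry; apply: wl => //; by rewrite refl_comm.
move=> imp sr st ru tu.
have rs : r != s by rewrite eq_sym.
have ts : t != s by rewrite eq_sym.
case: (boolP (adj s t)) => [est|nst]; last first.
  have nsr : ~~ adj s r by apply: contra nst.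
  rewrite !coef_step_nonedge //; try exact: coef_gt0; by rewrite !up_nonedge.
have ets : adj t s by rewrite edge_sym.
have gst := gram_edge est; have gts := gram_edge ets.
have ptr : pair t (refl r u) = pair t u by rewrite pair_refl gtr mulr0 subr0.
have prt : pair r (refl t u) = pair r u by rewrite pair_refl grt mulr0 subr0.
rewrite pair_refl ptr gst => top.
case: (boolP (adj s r)) imp => [esr _|nsr _].
  apply: coef_square_star => //; move: top.
  by rewrite pair_refl (gram_edge esr); real_lra.
have gsr := gram_nonedge sr nsr.
have nrs : ~~ adj r s by rewrite edge_sym.
have grs := gram_nonedge rs nrs.
have psr : pair s (refl r u) = pair s u by rewrite pair_refl gsr mulr0 subr0.
rewrite psr in top.
rewrite [RHS]coef_step_nonedge //; last exact: coef_gt0.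
have [su|su|su] := ltrgt0P (pair s u).
- have us : u != alpha s.
    by apply: (@neq_simple r); rewrite grs; real_lra.
  have [k nk dsu] := descent du us su.
  rewrite coef_step_gt0 ?psr ?ptr //; last by real_lra.
  rewrite (@up_gt0 n u s t) //; last by real_lra.
  rewrite refl_comm // nk /= up_nonedge //.
    by apply: up; rewrite nk.
  by rewrite pair_refl grs mulr0 subr0.
- rewrite coef_step_lt0 ?psr ?ptr // (@up_lt0 n u s t) // !up_nonedge //.
  by ring.
- rewrite coef_step_eq0 ?psr ?ptr // (@up_eq0 n u s t) // !up_nonedge //.
  by ring.
Qed.

(* [u] is the bottom of the hexagon of an edge [r t]. *)
Lemma coef_hexagon n r s t u :
  (forall m, (m <= n.+1)%N -> upward m) -> depth_root n u ->
  adj r t -> s != r -> s != t -> pair r u < 0 -> pair t u < 0 ->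
  pair s u + pair r u * (adj s r)%:R + pair t u * (adj s r)%:R
    + pair r u * (adj s t)%:R + pair t u * (adj s t)%:R <= 0 ->
  coef_step (coef n.+2) (coef n.+1) (refl r (refl t u)) s t =
  coef_step (coef n.+2) (coef n.+1) (refl t (refl r u)) s r.
Proof.
move=> up du ert sr st ru tu.
(* Without triangles [s] is adjacent to at most one end of the edge, taken to be [r]. The sum in the
   last hypothesis is [<alpha_s, r t r u>], the pairing at the top of the hexagon. *)
wlog nst : r t ert sr st ru tu / ~~ adj s t.
  move=> wl top; case: (boolP (adj s t)) => [est|nst]; last exact: wl.
  case: (boolP (adj s r)) => [esr|nsr].
    by exfalso; apply: (@no_tri r t s); rewrite 1?edge_sym // edge_sym.
  symmetry; apply: wl => //; first by rewrite edge_sym.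
  by move: top; real_lra.
rewrite (negbTE nst) !mulr0 !addr0 => top.
have ts : t != s by rewrite eq_sym.
have rs : r != s by rewrite eq_sym.
have etr : adj t r by rewrite edge_sym.
have nts : ~~ adj t s by rewrite edge_sym.
pose gE := (gram_nonedge st nst, gram_nonedge ts nts, gram_edge ert, gram_edge etr,
  gram_diag r, gram_diag s, gram_diag t).
have upn : upward n by apply: up.
have upn1 := up n.+1 (leqnn _).
have pstu : pair s (refl t u) = pair s u by rewrite pair_refl !gE; real_lra.
have prtu : pair r (refl t u) = pair r u + pair t u by rewrite pair_refl !gE; real_lra.
have prru : pair r (refl r u) = - pair r u by rewrite pair_refl !gE; real_lra.
have ptru : pair t (refl r u) = pair t u + pair r u by rewrite pair_refl !gE; real_lra.
have prtru : pair r (refl t (refl r u)) = pair t u.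
  by rewrite pair_refl !gE prru ptru; real_lra.
have dtu : depth_root n.+1 (refl t u) by exact: depth_refl.
have dru : depth_root n.+1 (refl r u) by exact: depth_refl.
rewrite coef_step_nonedge //; last exact: coef_gt0.
case: (boolP (adj s r)) top => [esr|nsr] top; last first.
  rewrite coef_step_nonedge //; last exact: coef_gt0.
  by rewrite !up_nonedge // ?ptru ?prtu; real_lra.
have ers : adj r s by rewrite edge_sym.
rewrite !mulr1 in top.
have psru : pair s (refl r u) = pair s u + pair r u.
  by rewrite pair_refl (gram_edge esr); real_lra.
have pstru : pair s (refl t (refl r u)) = pair s u + pair r u.
  by rewrite pair_refl !gE psru; real_lra.
(* The pairing of [alpha_r] with [r u] is positive, so the rule for that case leads back to the
   bottom [u]. *)
have ctru_r : coef n.+2 (refl t (refl r u)) r = 'X * coef n u t.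
  by rewrite up_gt0 ?prru ?ptru ?reflK //; real_lra.
have ctru_s : coef n.+2 (refl t (refl r u)) s = 'X * coef n.+1 (refl r u) s.
  by rewrite up_nonedge // ptru; real_lra.
have [su|su|su] := ltrgt0P (pair s u); last 2 first.
- rewrite coef_step_lt0 ?prtru ?pstru //; last by real_lra.
  rewrite up_lt0 ?prtu ?pstu //; last by real_lra.
  rewrite ctru_r ctru_s (@up_lt0 n u s r) // (@up_nonedge n u s t) //.
  rewrite (@up_lt0 n u r t) //.
  by ring.
- rewrite coef_step_lt0 ?prtru ?pstru //; last by real_lra.
  rewrite up_eq0 ?prtu ?pstu //; last by real_lra.
  rewrite ctru_r ctru_s (@up_eq0 n u s r) // (@up_nonedge n u s t) //.
  rewrite (@up_lt0 n u r t) //.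
  by ring.
have us : u != alpha s by apply: (@neq_simple t); rewrite !gE; real_lra.
have [k nk dv] := descent du us su; set v := refl s u in dv.
have uv : u = refl s v by rewrite reflK.
have psv : pair s v = - pair s u by rewrite pair_refl !gE; real_lra.
have prv : pair r v = pair s u + pair r u.
  by rewrite pair_refl (gram_edge ers); real_lra.
have ptv : pair t v = pair t u by rewrite pair_refl !gE; real_lra.
have upk : upward k by apply: up; rewrite nk leqW // leqnSn.
rewrite up_gt0 ?prtu ?pstu //; [|by real_lra..].
rewrite refl_comm // -/v nk /= -nk.
have cnut : coef n u t = 'X * coef k v t.
  by rewrite nk uv up_nonedge // psv; real_lra.
have crus : pair s u + pair r u <= 0 -> coef n.+1 (refl r u) s = 'X * coef k v r.
  by move=> sru; rewrite up_gt0 // nk.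
have [sru|sru|sru] := ltrgt0P (pair s u + pair r u); last 2 first.
- rewrite coef_step_lt0 ?prtru ?pstru // ctru_r ctru_s crus ?cnut; last by real_lra.
  by rewrite nk up_lt0 ?ptv ?prv //; ring.
- rewrite coef_step_eq0 ?prtru ?pstru // ctru_r ctru_s crus ?cnut; last by real_lra.
  by rewrite nk up_eq0 ?ptv ?prv //; ring.
rewrite coef_step_gt0 ?prtru ?pstru //.
have vr : v != alpha r.
  apply/negP => /eqP e; move: psv prv.
  by rewrite e !pair_simple !gE (gram_edge esr); real_lra.
have [|j kj dw] := descent dv vr; first by rewrite prv.
set w := refl r v in dw.
have psw : pair s w = pair r u by rewrite pair_refl (gram_edge esr) prv psv; real_lra.
rewrite nk up_gt0 ?ptv ?prv //.
rewrite -/w kj /=.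
have rus : refl r u != alpha s.
  by apply: (@neq_simple r); rewrite prru (gram_edge ers); real_lra.
have [|n' [n'n] dz] := descent dru rus; first by rewrite psru.
rewrite -n'n in dz; set z := refl s (refl r u) in dz.
have prz : pair r z = pair s u by rewrite pair_refl (gram_edge ers) prru psru; real_lra.
have ptz : pair t z = pair t u + pair r u by rewrite pair_refl !gE ptru; real_lra.
(* Since [s] and [t] commute, [s t r u = t z]; the braid relation [r s r u = s r s u] then
   identifies [r z] with [s w], and both sides end at [coef j w t]. *)
rewrite refl_comm // -/z -kj -nk up_gt0 ?prz ?ptz //; [|by real_lra..].
rewrite /z refl_braid // -/v -/w nk /= kj up_nonedge ?psw //.
by apply: up; rewrite nk kj !leqW // leqnSn.
Qed.

(** The recursion picks some [r] lowering [t u], possibly different from [t]. Both choices are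
    rewritten from the bottom of the orbit under [r] and [t], where the square and hexagon
    comparisons need the claim only at smaller depths. *)
Lemma coef_upward n : upward n.
Proof.
elim/ltn_ind: n => n up u t s du tu st; rewrite coefS.
have tb : 0 < pair t (refl t u) by rewrite pair_refl gram_diag; real_lra.
case: pickP => [r rb|/(_ t)]; last by rewrite tb.
case: (ltrP 0 (pair s (refl t u))) => [sb|sb]; first by rewrite /coef_step reflK sb.
have sr : s != r by apply: contraTneq rb => <-; rewrite -leNgt.
have [->|rt] := eqVneq r t; first by rewrite reflK.
have tr : t != r by rewrite eq_sym.
case: (boolP (adj r t)) => [ert|nrt]; last first.
  have ntr : ~~ adj t r by rewrite edge_sym.
  have grt := gram_nonedge rt nrt; have gtr := gram_nonedge tr ntr.
  move: rb; rewrite pair_refl grt mulr0 subr0 => ru.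
  have ur : u != alpha r by apply: (@neq_simple t); rewrite gtr; real_lra.
  have [m nm dw] := descent du ur ru.
  have uw : u = refl r (refl r u) by rewrite reflK.
  rewrite refl_comm // uw reflK nm; symmetry; apply: coef_square => //.
  - by move=> l lm; apply: up; rewrite nm.
  - by rewrite pair_refl gram_diag; real_lra.
  - by rewrite pair_refl gtr; real_lra.
  - by rewrite reflK.
have etr : adj t r by rewrite edge_sym.
pose gE := (gram_edge ert, gram_edge etr, gram_diag r, gram_diag t).
have tri : adj s r -> ~~ adj s t.
  move=> esr; apply/negP => est.
  by apply: (@no_tri r t s); rewrite 1?edge_sym // edge_sym.
have prb : pair r (refl t u) = pair r u + pair t u by rewrite pair_refl !gE; real_lra.
rewrite prb in rb.
(* Then [t u = alpha_r + alpha_t] and the orbit has no bottom root; the two candidates start from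
   [alpha_t] and [alpha_r], and both give ['X]. *)
have [ur|ur] := eqVneq u (alpha r).
  have n0 : n = 0%N by move: du; rewrite ur; apply: depth_simple.
  have -> : refl r (refl t u) = alpha t.
    by rewrite ur -refl_simple_edge // reflK.
  rewrite ur n0 {n up du tu tb sb prb rb ur n0 u}.
  have simple q q' : q != q' -> s != q -> s != q' -> adj q q' -> adj s q' ->
      ~~ adj s q ->
      coef_step (coef 0) (coef 0.-1) (alpha q) s q' = 'X.
    move=> qq' sq sq' eqq' esq' nsq.
    rewrite coef_step_eq0 ?pair_simple ?(gram_nonedge sq nsq) //.
      by rewrite !coef_simple // 1?eq_sym //; ring.
    by rewrite gram_edge 1?edge_sym //; real_lra.
  have simple0 q q' : s != q -> s != q' -> ~~ adj s q' ->
      coef_step (coef 0) (coef 0.-1) (alpha q) s q' = 'X.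
    move=> sq sq' nsq'; rewrite coef_step_nonedge //; last exact: coef_gt0.
    by rewrite coef_simple // mulr1.
  case: (boolP (adj s r)) (tri) => [esr /(_ isT) nst|nsr _].
    by rewrite simple // simple0.
  rewrite simple0 //; case: (boolP (adj s t)) => [est|nst]; first by rewrite simple.
  by rewrite simple0.
(* Two more descents, along [r] and then [t], reach the bottom [z], and [t u = t r t z] is the top
   of its hexagon. *)
have [|m nm dw] := descent du ur.
  by real_lra.
set w := refl r u in dw.
have prw : pair r w = - pair r u by rewrite pair_refl !gE; real_lra.
have ptw : pair t w = pair r u + pair t u by rewrite pair_refl !gE; real_lra.
have wt : w != alpha t.
  by apply/negP => /eqP e; move: prw ptw; rewrite e !pair_simple !gE; real_lra.
have [|l ml dz] := descent dw wt; first by rewrite ptw.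
set z := refl t w in dz.
have wz : w = refl t z by rewrite reflK.
have uz : u = refl r (refl t z) by rewrite -wz reflK.
have ptz : pair t z = - (pair r u + pair t u) by rewrite pair_refl !gE ptw; real_lra.
have prz : pair r z = pair t u by rewrite pair_refl !gE prw ptw; real_lra.
clearbody z.
have -> : refl r (refl t u) = refl t (refl r z).
  by rewrite uz refl_braid // reflK.
rewrite uz nm ml; symmetry; apply: coef_hexagon => //.
- by move=> k lk; apply: up; rewrite nm ml ltnS.
- by rewrite prz.
- by rewrite ptz; real_lra.
- move: sb; rewrite uz !pair_refl !gE !(gram_neq sr, gram_neq st) prz ptz.
  by real_lra.
Qed.

(** When [s] and [t] both fix [u], the edge condition on the forms at [e_u] reduces to
    [T_s(e_u) = T_t(e_u)]. *)
Lemma coef_fork n u s t : depth_root n u -> adj s t -> pair s u = 0 -> pair t u = 0 ->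
  coef n u s = coef n u t.
Proof.
elim/ltn_ind: n u s t => n IH b s t db.
case: (depth_case db) => [[r br]|].
  have n0 : n = 0%N by move: db; rewrite br; apply: depth_simple.
  rewrite n0 br {n0 br db IH}.
  move=> est; rewrite !pair_simple => sr tr.
  have neq q : g q r = 0 -> q != r.
    by move=> qr; apply/negP => /eqP e; move: qr; rewrite e gram_diag; real_lra.
  by rewrite !coef_simple ?neq.
move=> [m [r [u [nm bu du ru]]]] est.
clear db; rewrite bu nm in IH *; clear b bu n nm; rename m into n.
wlog nrt : s t est / ~~ adj r t.
  move=> wl su tu; case: (boolP (adj r t)) => [ert|nrt]; last exact: wl.
  case: (boolP (adj r s)) => [ers|nrs].
    by case: (no_tri ers ert est).
  by symmetry; apply: wl => //; rewrite edge_sym.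
have up := coef_upward.
have rb : pair r (refl r u) = - pair r u by rewrite pair_refl gram_diag; real_lra.
move=> sb tb.
have neq q : pair q (refl r u) = 0 -> r != q.
  by move=> qb; apply/eqP => e; move: rb; rewrite {1}e qb => ?; real_lra.
have rs := neq s sb; have rt := neq t tb.
have sr : s != r by rewrite eq_sym.
have tr : t != r by rewrite eq_sym.
have ntr : ~~ adj t r by rewrite edge_sym.
have ets : adj t s by rewrite edge_sym.
pose gE := (gram_nonedge rt nrt, gram_nonedge tr ntr, gram_edge est, gram_edge ets,
  gram_diag r, gram_diag s, gram_diag t).
have ptu : pair t u = 0 by rewrite -tb pair_refl !gE; real_lra.
rewrite [RHS]up_nonedge //.
case: (boolP (adj s r)) => [esr|nsr]; last first.
  rewrite up_nonedge //; congr (_ * _); apply: IH => //.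
  by rewrite -sb pair_refl gram_nonedge //; real_lra.
have ers : adj r s by rewrite edge_sym.
have psu : pair s u = - pair r u.
  by move: sb; rewrite pair_refl (gram_edge esr); real_lra.
rewrite up_gt0 ?psu //; [congr (_ * _)|by real_lra..].
(* The root [w = t s u], three steps below [r u], is fixed by [s] and [r]: the induction trades the
   edge [s t] at [r u] for the edge [r s] at [w]. *)
have us : u != alpha s by apply: (@neq_simple t); rewrite !gE; real_lra.
have [|k nk dv] := descent du us; first by real_lra.
set v := refl s u in dv *.
have uv : u = refl s v by rewrite reflK.
have psv : pair s v = pair r u by rewrite pair_refl !gE psu; real_lra.
have prv : pair r v = 0 by rewrite pair_refl (gram_edge ers) psu; real_lra.
have ptv : pair t v = - pair r u by rewrite pair_refl !gE psu ptu; real_lra.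
have vt : v != alpha t.
  by apply/negP => /eqP e; move: psv ptv; rewrite e !pair_simple !gE; real_lra.
have [|j kj dw] := descent dv vt; first by real_lra.
set w := refl t v in dw.
have vw : v = refl t w by rewrite reflK.
have psw : pair s w = 0 by rewrite pair_refl !gE psv ptv; real_lra.
have prw : pair r w = 0 by rewrite pair_refl !gE prv; real_lra.
have ptw : pair t w = pair r u by rewrite pair_refl !gE ptv; real_lra.
rewrite nk /= uv up_gt0 ?psv ?ptv //; [|by real_lra..].
rewrite -/w kj /= vw up_nonedge ?ptw //; congr (_ * _).
by apply: IH => //; rewrite nk kj ltnS leqW // leqnSn.
Qed.

(** Descending along [s] and [t] as long as a pairing is positive ends at a root where neither is,
    unless it meets [alpha s] or [alpha t]. Hence a property may be checked one orbit at a time. *)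
Lemma square_ind (P : X -> Prop) s t : s != t -> ~~ adj s t ->
  P (alpha s) -> P (alpha t) ->
  (forall n u, depth_root n u -> pair s u <= 0 -> pair t u <= 0 ->
    [/\ P u, P (refl s u), P (refl t u) & P (refl s (refl t u))]) ->
  forall n u, depth_root n u -> P u.
Proof.
move=> st nst Ps Pt bottom n u du.
have ts : t != s by rewrite eq_sym.
have nts : ~~ adj t s by rewrite edge_sym.
pose gE := (gram_nonedge st nst, gram_nonedge ts nts, gram_diag s, gram_diag t).
have [su|su] := lerP (pair s u) 0.
  have [tu|tu] := lerP (pair t u) 0; first by case: (bottom n u).
  have [->//|ut] := eqVneq u (alpha t).
  have [m _ dv] := descent du ut tu.
  rewrite -[u](reflK t); case: (bottom m (refl t u)) => //.
    by rewrite pair_refl !gE; real_lra.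
  by rewrite pair_refl !gE; real_lra.
have [->//|us] := eqVneq u (alpha s).
have [m _ dv] := descent du us su.
have psv : pair s (refl s u) = - pair s u by rewrite pair_refl !gE; real_lra.
have ptv : pair t (refl s u) = pair t u by rewrite pair_refl !gE; real_lra.
rewrite -[u](reflK s).
have [tu|tu] := lerP (pair t u) 0.
  by case: (bottom m (refl s u)) => //; rewrite ?psv ?ptv //; real_lra.
have vt : refl s u != alpha t by apply: (@neq_simple s); rewrite psv !gE; real_lra.
have [|l _ dw] := descent dv vt; first by rewrite ptv.
rewrite -[refl s u](reflK t); case: (bottom l _ dw) => //.
  by rewrite pair_refl !gE psv; real_lra.
by rewrite pair_refl !gE ptv; real_lra.
Qed.

Let hexagon_bottom (P : X -> Prop) s t := forall n u,
  depth_root n u -> pair s u <= 0 -> pair t u <= 0 ->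
  P u /\ [/\ P (refl s u), P (refl t u), P (refl s (refl t u)),
    P (refl t (refl s u)) & P (refl s (refl t (refl s u)))].

(** At most three descents, along [s], [t] and [s], reach a bottom root; the only exceptions are
    [u = alpha s] and, after one descent, [alpha t]. The other half of the hexagon follows by
    exchanging [s] and [t]. *)
Let hexagon_half (P : X -> Prop) s t n u : adj s t ->
  P (alpha s) -> P (refl s (alpha t)) -> hexagon_bottom P s t ->
  depth_root n u -> 0 < pair s u -> P u.
Proof.
move=> st Ps Pst bottom du su.
have ts : adj t s by rewrite edge_sym.
pose gE := (gram_edge st, gram_edge ts, gram_diag s, gram_diag t).
have [->//|us] := eqVneq u (alpha s).
have [m _ dv] := descent du us su.
have psv : pair s (refl s u) = - pair s u by rewrite pair_refl !gE; real_lra.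
have ptv : pair t (refl s u) = pair s u + pair t u by rewrite pair_refl !gE; real_lra.
rewrite -[u](reflK s); move: (refl s u) dv psv ptv => v dv psv ptv.
have [tv|tv] := lerP (pair t v) 0.
  by case: (bottom m v) => // [|_ []]; first by rewrite psv; real_lra.
have [->//|vt] := eqVneq v (alpha t).
have [l _ dw] := descent dv vt tv.
have psw : pair s (refl t v) = pair t u by rewrite pair_refl !gE psv ptv; real_lra.
have ptw : pair t (refl t v) = - pair t v by rewrite pair_refl !gE; real_lra.
rewrite -[v](reflK t); move: (refl t v) dw psw ptw => w dw psw ptw.
have [tu|tu] := lerP (pair t u) 0.
  by case: (bottom l w) => // [| |_ []] //; rewrite ?psw ?ptw //; real_lra.
have ws : w != alpha s.
  by apply/negP => /eqP e; move: psw ptw; rewrite e !pair_simple !gE ptv; real_lra.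
have [|k _ dz] := descent dw ws; first by rewrite psw.
rewrite -[w](reflK s).
case: (bottom k (refl s w)) => // [| |_ []] //.
  by rewrite pair_refl !gE psw; real_lra.
by rewrite pair_refl !gE ptw ptv psw; real_lra.
Qed.

Lemma hexagon_ind (P : X -> Prop) s t : adj s t ->
  P (alpha s) -> P (alpha t) -> P (refl s (alpha t)) ->
  (forall n u, depth_root n u -> pair s u <= 0 -> pair t u <= 0 ->
    P u /\ [/\ P (refl s u), P (refl t u), P (refl s (refl t u)),
      P (refl t (refl s u)) & P (refl s (refl t (refl s u)))]) ->
  forall n u, depth_root n u -> P u.
Proof.
move=> st Ps Pt Pst bottom n u du.
have ts : adj t s by rewrite edge_sym.
have [su|su] := lerP (pair s u) 0; last exact: (hexagon_half st Ps Pst bottom du su).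
have [tu|tu] := lerP (pair t u) 0; first by case: (bottom n u).
apply: (hexagon_half ts Pt _ _ du tu); first by rewrite refl_simple_edge.
move=> m v dv tv sv; have [Pv [Psv Ptv Pstv Ptsv Pstsv]] := bottom m v dv sv tv.
by split=> //; split=> //; rewrite -refl_braid.
Qed.

End ReflectionCoefficients.

(** * Rank one deformations *)

Section Deformation.
Variables (K : fieldType) (V : lmodType K) (x y : K).

Definition rank_one_deformation (f : V -> V) (tau : V -> K^o) (e v : V) : V :=
  f v + (x * tau v) *: e.

Lemma deformation_comm (fs ft : {linear V -> V}) (ts tt : {linear V -> K^o})
    es et v :
  fs (ft v) = ft (fs v) -> fs et = et -> ft es = es ->
  ts (ft v) = ts v -> tt (fs v) = tt v -> ts et = 0 -> tt es = 0 ->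
  rank_one_deformation fs ts es (rank_one_deformation ft tt et v) =
  rank_one_deformation ft tt et (rank_one_deformation fs ts es v).
Proof.
rewrite /rank_one_deformation => ff fet fes tsf ttf tse tte.
rewrite !linearD !linearZ /= ff fet fes tsf ttf tse tte !scaler0 !addr0.
by rewrite -!addrA; congr (_ + _); rewrite addrC.
Qed.

(** The terms in [x^2] vanish, because [ts et = tt es = 0] and [ts (ft es) = tt (fs es) = 0]. What
    is left is symmetric in [s] and [t] once [ts ft = tt fs] and [fs ft fs = ft fs ft], which yields
    the braid relation. *)
Lemma deformation_sts (fs ft : {linear V -> V}) (ts tt : {linear V -> K^o})
    es et e v :
  fs es = 0 -> fs et = (1 - y) *: et + e -> ft es = (1 - y) *: es + e ->
  fs e = y *: et -> (forall w, ts (ft w) = tt (fs w)) ->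
  ts et = 0 -> tt es = 0 ->
  tt (fs (fs v)) = (1 - y) * tt (fs v) + y * tt v ->
  rank_one_deformation fs ts es (rank_one_deformation ft tt et
    (rank_one_deformation fs ts es v)) =
  fs (ft (fs v)) + (x * (y * ts v + (1 - y) * tt (fs v))) *: et
    + (x * (y * tt v + (1 - y) * tt (fs v))) *: es + (x * tt (fs v)) *: e.
Proof.
move=> fes fet ftes fse tf tse tte q; rewrite /rank_one_deformation.
have fsft : fs (ft es) = y *: et by rewrite ftes linearD linearZ /= fes scaler0 add0r.
rewrite !linearD !linearZ /= tte fsft fet !tf fes linear0 q tse !scaler0 !addr0.
rewrite scalerDr !scalerA -!addrA; congr (_ + _).
rewrite linear0 scaler0 addr0 [in LHS]addrA -scalerDl [X in _ + X = _]addrC.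
by congr (_ *: _ + (_ *: _ + _)); ring.
Qed.

Lemma deformation_braid (fs ft : {linear V -> V}) (ts tt : {linear V -> K^o})
    es et e v :
  fs (ft (fs v)) = ft (fs (ft v)) ->
  fs es = 0 -> ft et = 0 ->
  fs et = (1 - y) *: et + e -> ft es = (1 - y) *: es + e ->
  fs e = y *: et -> ft e = y *: es ->
  (forall w, ts (ft w) = tt (fs w)) -> ts et = 0 -> tt es = 0 ->
  tt (fs (fs v)) = (1 - y) * tt (fs v) + y * tt v ->
  ts (ft (ft v)) = (1 - y) * ts (ft v) + y * ts v ->
  rank_one_deformation fs ts es (rank_one_deformation ft tt et
    (rank_one_deformation fs ts es v)) =
  rank_one_deformation ft tt et (rank_one_deformation fs ts es
    (rank_one_deformation ft tt et v)).
Proof.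
move=> ff fes fet fset ftes fse fte tf tse tte qt qs.
rewrite (deformation_sts fes fset ftes fse tf tse tte qt).
rewrite (deformation_sts fet ftes fset fte (fun w => esym (tf w)) tte tse qs).
by rewrite ff tf; congr (_ + _); exact: addrAC.
Qed.

(** Since [f] kills [e], the rank one term disturbs the quadratic relation of [f] only along the
    line of [e]. *)
Lemma deformation_defect (f : {linear V -> V}) (tau : {linear V -> K^o}) e v :
  f e = 0 -> f (f v) = (1 - y) *: f v + y *: v ->
  let psi := rank_one_deformation f tau e in
  psi (psi v) - (1 - y) *: psi v - y *: v =
  (x * tau (f v) + x * (x * tau v * tau e) - (1 - y) * (x * tau v)) *: e.
Proof.
move=> fe ffv psi; rewrite {}/psi /rank_one_deformation; set k := x * tau v.
have -> : f (f v + k *: e) = (1 - y) *: f v + y *: v.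
  by rewrite linearD linearZ /= fe scaler0 addr0.
have -> : tau (f v + k *: e) = tau (f v) + k * tau e by rewrite linearD linearZ.
have cancel (A B C D : V) : A + B + C - (A + D) - B = C - D.
  apply: (addIr B); rewrite subrK; apply: (addIr (A + D)); rewrite subrK.
  rewrite (addrC A D) addrA [C - D + B]addrAC subrK.
  by rewrite [C + B]addrC [RHS]addrC addrA.
by rewrite scalerDr cancel scalerA -scalerBl mulrDr.
Qed.

End Deformation.

(** The map [f] is annihilated by [(X - c)(X^2 - (1 - y)X - y)], because the quadratic factor sends
    [V] into the line of the eigenvector [e]. The constant term [c y] is nonzero, so the inverse is
    a polynomial in [f], whatever the dimension of [V]. *)
Lemma bijective_of_defect (K : fieldType) (V : lmodType K) (f : V -> V)
    (e : V) (c y : K) :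
  linear f -> c != 0 -> y != 0 -> f e = c *: e ->
  (forall v, exists k, f (f v) - (1 - y) *: f v - y *: v = k *: e) ->
  bijective f.
Proof.
move=> lf c0 y0 fe line.
pose F : {linear V -> V} := HB.pack f (GRing.isLinear.Build K V V _ f lf).
have fZ a u : f (a *: u) = a *: f u by exact: (linearZ_LR F).
have fB u v : f (u - v) = f u - f v by exact: (linearB F).
pose Q v := f (f v) - (1 - y) *: f v - y *: v.
have fQ v : f (Q v) = Q (f v) by rewrite /Q !fB !fZ.
have QK v : f (f v) - (1 - y) *: f v - Q v = y *: v by rewrite /Q subKr.
have cubic v : f (Q v) = c *: Q v.
  by have [k Qv] := line v; rewrite /Q Qv fZ fe !scalerA mulrC.
exists (fun v => y^-1 *: (f v - (1 - y) *: v - c^-1 *: Q v)) => v.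
  by rewrite -fQ cubic scalerK // QK scalerK.
by rewrite fZ !fB !fZ cubic scalerK // QK scalerK.
Qed.

Section Extension.
Variables (R : realType) (S : finType) (M : coxeter_matrix S).
Local Notation module := (root_module R M).

Lemma root_module_ind (P : module -> Prop) : P 0 ->
  (forall a u v, P u -> P v -> P (a *: u + v)) ->
  (forall u, is_pos_root M u -> P (root_basis M u)) -> forall v, P v.
Proof.
move=> P0 Plin Pbasis v; rewrite -[v]freeg_sumE.
elim: (dom v) => [|b r IH]; first by rewrite big_nil.
rewrite big_cons; have -> : << coeff b v *g b >> = coeff b v *: << b >> :> module.
  by apply/eqP/freeg_eqP => z; rewrite coeffZ !coeffU mul1r.
apply: Plin IH; rewrite -root_basisE; apply: Pbasis.
by apply/asboolP; exact: (valP b).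
Qed.
End Extension.

HB.instance Definition _ (R : realType) (S : finType) (M : coxeter_matrix S) s :=
  GRing.Linear.copy (@phi R S M s) (linear_extension (@phi_basis R S M s)).

HB.instance Definition _ (R : realType) (S : finType) (M : coxeter_matrix S) T s :=
  GRing.Linear.copy (@psi R S M T s) (linear_extension (fun b : pos_root R M =>
    phi s (root_basis M b)
    + (ratfun_x * ratfun_of_y (T s b)) *: root_basis M (simple_root R s))).

(** * The relations on single orbits of two generators *)

Section Tables.
Variables (K : fieldType) (I : choiceType) (y : K).
Local Notation V := {freeg I / K}.
Variables (fs ft : {linear V -> V}).

Let braid v := fs (ft (fs v)) = ft (fs (ft v)).

Let fD := ((fun u v : V => linearD fs u v), (fun u v : V => linearD ft u v)).
Let fZ := ((fun a (v : V) => linearZZ fs a v), (fun a (v : V) => linearZZ ft a v)).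

Local Ltac solve_table E :=
  rewrite /braid; rewrite !(E, fD, fZ);
  apply/eqP/freeg_eqP => z; rewrite !(coeffD, coeffZ); ring.

Lemma braid_regular e0 e_s e_t e_st e_ts e_sts :
  fs e0 = (1 - y) *: e0 + e_s -> ft e0 = (1 - y) *: e0 + e_t ->
  fs e_s = y *: e0 -> ft e_s = (1 - y) *: e_s + e_ts ->
  ft e_t = y *: e0 -> fs e_t = (1 - y) *: e_t + e_st ->
  fs e_st = y *: e_t -> ft e_st = (1 - y) *: e_st + e_sts ->
  ft e_ts = y *: e_s -> fs e_ts = (1 - y) *: e_ts + e_sts ->
  fs e_sts = y *: e_ts -> ft e_sts = y *: e_st ->
  braid e0 /\ [/\ braid e_s, braid e_t, braid e_st, braid e_ts & braid e_sts].
Proof.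
move=> E1 E2 E3 E4 E5 E6 E7 E8 E9 E10 E11 E12.
pose E := (E1, E2, E3, E4, E5, E6, E7, E8, E9, E10, E11, E12).
split; first by solve_table E.
by split; solve_table E.
Qed.

(** This is the hexagon whose bottom is fixed by [s], so that only three of its roots remain. *)
Lemma braid_wall e0 e_t e_st :
  fs e0 = e0 -> ft e0 = (1 - y) *: e0 + e_t ->
  ft e_t = y *: e0 -> fs e_t = (1 - y) *: e_t + e_st ->
  fs e_st = y *: e_t -> ft e_st = e_st ->
  [/\ braid e0, braid e_t & braid e_st].
Proof.
move=> E1 E2 E3 E4 E5 E6.
pose E := (E1, E2, E3, E4, E5, E6).
by split; solve_table E.
Qed.

Lemma braid_simple es et e :
  fs es = 0 -> ft et = 0 ->
  fs et = (1 - y) *: et + e -> ft es = (1 - y) *: es + e ->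
  fs e = y *: et -> ft e = y *: es ->
  [/\ braid es, braid et & braid e].
Proof.
move=> E1 E2 E3 E4 E5 E6.
pose E := (E1, E2, E3, E4, E5, E6).
by split; rewrite /braid !(E, fD, fZ, linear0, scaler0, addr0).
Qed.

Lemma commute_regular e0 e_s e_t e_st :
  fs e0 = (1 - y) *: e0 + e_s -> ft e0 = (1 - y) *: e0 + e_t ->
  fs e_s = y *: e0 -> ft e_s = (1 - y) *: e_s + e_st ->
  ft e_t = y *: e0 -> fs e_t = (1 - y) *: e_t + e_st ->
  fs e_st = y *: e_t -> ft e_st = y *: e_s ->
  [/\ fs (ft e0) = ft (fs e0), fs (ft e_s) = ft (fs e_s),
    fs (ft e_t) = ft (fs e_t) & fs (ft e_st) = ft (fs e_st)].
Proof.
move=> E1 E2 E3 E4 E5 E6 E7 E8.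
pose E := (E1, E2, E3, E4, E5, E6, E7, E8).
by split; solve_table E.
Qed.

Variables ts tt : {linear V -> K^o}.

Let agree v := ts (ft v) = tt (fs v).
Let tD := ((fun u v : V => linearD ts u v), (fun u v : V => linearD tt u v)).
Let tZ a v : (ts (a *: v) = a * ts v) * (tt (a *: v) = a * tt v).
Proof. by split; exact: linearZZ. Qed.

Local Ltac solve_forms E := rewrite /agree; rewrite !(E, tD, tZ); ring.

(** Here [q] stands for [y^n] at a bottom root of depth [n], while [a] and [b] are the values of
    [N_s] and [N_t] there; the hypotheses on the forms are what the recursion gives on the rest of
    the hexagon. *)
Lemma agree_regular e0 e_s e_t e_st e_ts e_sts (q a b : K) :
  fs e0 = (1 - y) *: e0 + e_s -> ft e0 = (1 - y) *: e0 + e_t ->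
  fs e_s = y *: e0 -> ft e_s = (1 - y) *: e_s + e_ts ->
  ft e_t = y *: e0 -> fs e_t = (1 - y) *: e_t + e_st ->
  fs e_st = y *: e_t -> ft e_st = (1 - y) *: e_st + e_sts ->
  ft e_ts = y *: e_s -> fs e_ts = (1 - y) *: e_ts + e_sts ->
  fs e_sts = y *: e_ts -> ft e_sts = y *: e_st ->
  ts e0 = (y - 1) * (q - a) -> tt e0 = (y - 1) * (q - b) ->
  ts e_s = (y - 1) * (y * q) -> tt e_s = (y - 1) * (y * q - (y * b + a)) ->
  tt e_t = (y - 1) * (y * q) -> ts e_t = (y - 1) * (y * q - (y * a + b)) ->
  ts e_st = (y - 1) * (y ^+ 2 * q) -> tt e_st = (y - 1) * (y ^+ 2 * q - y * a) ->
  tt e_ts = (y - 1) * (y ^+ 2 * q) -> ts e_ts = (y - 1) * (y ^+ 2 * q - y * b) ->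
  ts e_sts = (y - 1) * (y ^+ 3 * q) -> tt e_sts = (y - 1) * (y ^+ 3 * q) ->
  agree e0 /\ [/\ agree e_s, agree e_t, agree e_st, agree e_ts & agree e_sts].
Proof.
move=> E1 E2 E3 E4 E5 E6 E7 E8 E9 E10 E11 E12.
move=> F1 F2 F3 F4 F5 F6 F7 F8 F9 F10 F11 F12.
pose E := (E1, E2, E3, E4, E5, E6, E7, E8, E9, E10, E11, E12,
  (F1, F2, F3, F4, F5, F6, F7, F8, F9, F10, F11, F12)).
split; first by solve_forms E.
by split; solve_forms E.
Qed.

Lemma agree_wall e0 e_t e_st (q a b : K) :
  fs e0 = e0 -> ft e0 = (1 - y) *: e0 + e_t ->
  ft e_t = y *: e0 -> fs e_t = (1 - y) *: e_t + e_st ->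
  fs e_st = y *: e_t -> ft e_st = e_st ->
  ts e0 = (y - 1) * (q - a) -> tt e0 = (y - 1) * (q - b) ->
  tt e_t = (y - 1) * (y * q) ->
  ts e_t = (y - 1) * (y * q - ((y - 1) * a + b)) ->
  ts e_st = (y - 1) * (y ^+ 2 * q) -> tt e_st = (y - 1) * (y ^+ 2 * q - y * a) ->
  [/\ agree e0, agree e_t & agree e_st].
Proof.
move=> E1 E2 E3 E4 E5 E6 F1 F2 F3 F4 F5 F6.
pose E := (E1, E2, E3, E4, E5, E6, (F1, F2, F3, F4, F5, F6)).
by split; solve_forms E.
Qed.

End Tables.

Lemma ratfun_of_yM p q : ratfun_of_y (p * q) = ratfun_of_y p * ratfun_of_y q.
Proof. by rewrite /ratfun_of_y polyCM tofracM. Qed.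

Lemma ratfun_of_yD p q : ratfun_of_y (p + q) = ratfun_of_y p + ratfun_of_y q.
Proof. by rewrite /ratfun_of_y polyCD tofracD. Qed.

Lemma ratfun_of_yB p q : ratfun_of_y (p - q) = ratfun_of_y p - ratfun_of_y q.
Proof. by rewrite /ratfun_of_y polyCB tofracB. Qed.

Lemma ratfun_of_y0 : ratfun_of_y 0 = 0.
Proof. by rewrite /ratfun_of_y tofrac0. Qed.

Lemma ratfun_of_y1 : ratfun_of_y 1 = 1.
Proof. by rewrite /ratfun_of_y tofrac1. Qed.

Lemma ratfun_of_yXn n : ratfun_of_y 'X^n = ratfun_y ^+ n.
Proof. by rewrite /ratfun_y /ratfun_of_y -tofracXn -rmorphXn. Qed.

Lemma ratfun_x_neq0 : ratfun_x != 0.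
Proof. by rewrite /ratfun_x tofrac_eq0 polyX_eq0. Qed.

Lemma ratfun_y_neq0 : ratfun_y != 0.
Proof. by rewrite /ratfun_y /ratfun_of_y tofrac_eq0 polyC_eq0 polyX_eq0. Qed.

(** * Positive roots and the representation *)

Section Roots.
Variables (R : realType) (S : finType) (M : coxeter_matrix S).
Hypotheses (smallM : small_type M) (notriM : no_triangle M).

Local Notation adj := (cox_edge M).
Local Notation alpha := (@simple_root R S).
Local Notation pair s u := (cox_form M (alpha s) u).
Local Notation refl := (@cox_refl R S M).
Local Notation g := (cox_gram R M).
Local Notation root := (root_space R S).

(** * The Gram matrix in small type and the reflections *)

Lemma cox_edge_sym s t : adj s t = adj t s.
Proof. by rewrite /cox_edge cox_sym. Qed.

Lemma cox_edge_irr s : adj s s = false.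
Proof. by rewrite /cox_edge cox_diag. Qed.

Lemma cox_edge_neq s t : adj s t -> s != t.
Proof. by apply: contraTneq => ->; rewrite cox_edge_irr. Qed.

Lemma small_edge s t : adj s t -> M s t = Some 3%N.
Proof.
by move=> st; move: (st); rewrite /cox_edge; case: (smallM (cox_edge_neq st)) => ->.
Qed.

Lemma small_nonedge s t : s != t -> ~~ adj s t -> M s t = Some 2%N.
Proof. by move=> st; rewrite /cox_edge; case: (smallM st) => ->. Qed.

Lemma cos_pi3 : cos (pi / 3%:R) = 1 / 2 :> R.
Proof.
set c := cos _.
have c0 : 0 < c.
  apply: cos_gt0_pihalf; have := pi_gt0 R => p0; apply/andP; split; lra.
(* The triple angle formula turns [cos pi = -1] into [(c + 1)(2c - 1)^2 = 0], and [c > 0] leaves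
   only [1/2]. *)
have : cos (pi / 3%:R + (pi / 3%:R) *+ 2) = -1 :> R.
  have div3 (a : R) : a / 3%:R + (a / 3%:R) *+ 2 = a by lra.
  by rewrite div3 cospi.
rewrite cosD cos_mulr2n sin_mulr2n; have := sin2cos2 (pi / 3%:R : R); rewrite -/c.
set d := sin _ => d2 h.
have : (c + 1) * (2 * c - 1) ^+ 2 = 0.
  rewrite (_ : _ * _ = c * (c ^+ 2 *+ 2 - 1) - d * ((c * d) *+ 2) + 1
    + 2 * c * (d ^+ 2 - (1 - c ^+ 2))); last by ring.
  by rewrite h d2 !subrr mulr0 addr0 addNr.
move/eqP; rewrite mulf_eq0 sqrf_eq0 => /orP[]/eqP; lra.
Qed.

Lemma gramE s t : g s t = if s == t then 2 else if adj s t then -1 else 0.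
Proof.
rewrite /cox_gram; case: eqVneq => [<-|st].
  by rewrite cox_diag divr1 cospi mulrN1 opprK.
case: ifP => [e|/negbT e].
  by rewrite small_edge // cos_pi3; field.
by rewrite small_nonedge // cos_pihalf mulr0.
Qed.

Lemma gram_diag s : g s s = 2.
Proof. by rewrite gramE eqxx. Qed.

Lemma gram_edge s t : adj s t -> g s t = -1.
Proof. by move=> st; rewrite gramE st (negbTE (cox_edge_neq st)). Qed.

Lemma gram_nonedge s t : s != t -> ~~ adj s t -> g s t = 0.
Proof. by move=> /negbTE st /negbTE e; rewrite gramE st e. Qed.

Lemma simple_rootE s t : alpha s t = (t == s)%:R.
Proof. by rewrite ffunE. Qed.

Lemma pairE s u : pair s u = \sum_t (u t : R) * g s t.
Proof.
rewrite /cox_form (bigD1 s) //= [X in _ + X]big1 ?addr0.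
  by apply: eq_bigr => t _; rewrite simple_rootE eqxx mul1r.
move=> r /negbTE rs; apply: big1 => t _.
by rewrite simple_rootE rs !mul0r.
Qed.

Lemma pair_simple s t : pair s (alpha t) = g s t.
Proof.
rewrite pairE (bigD1 t) //= [X in _ + X]big1 ?addr0.
  by rewrite simple_rootE eqxx mul1r.
by move=> r /negbTE rt; rewrite simple_rootE rt mul0r.
Qed.

Lemma pairD s u v : pair s (u + v) = pair s u + pair s v.
Proof.
by rewrite !pairE -big_split; apply: eq_bigr => t _; rewrite ffunE mulrDl.
Qed.

Lemma pairZ s (a : R) u : pair s (a *: u) = a * pair s u.
Proof.
by rewrite !pairE mulr_sumr; apply: eq_bigr => t _; rewrite ffunE -mulrA.
Qed.

Lemma pairN s u : pair s (- u) = - pair s u.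
Proof. by rewrite -scaleN1r pairZ mulN1r. Qed.

Lemma pair0 s : pair s 0 = 0.
Proof. by rewrite -(scale0r (0 : root)) pairZ mul0r. Qed.

Lemma pair_refl s t u : pair s (refl t u) = pair s u - pair t u * g s t.
Proof. by rewrite /cox_refl pairD pairN pairZ pair_simple. Qed.

Lemma pair_refl_diag s u : pair s (refl s u) = - pair s u.
Proof.
by rewrite pair_refl gram_diag // mulr_natr mulr2n opprD addNKr.
Qed.

Lemma pair_refl_edge s t u : adj s t -> pair s (refl t u) = pair s u + pair t u.
Proof. by move=> st; rewrite pair_refl gram_edge // mulrN1 opprK. Qed.

Lemma pair_refl_nonedge s t u : s != t -> ~~ adj s t -> pair s (refl t u) = pair s u.
Proof. by move=> st nst; rewrite pair_refl gram_nonedge // mulr0 subr0. Qed.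

Lemma reflE s (u : root) t : (refl s u t : R) = u t - pair s u * (t == s)%:R.
Proof. by rewrite /cox_refl !ffunE. Qed.

Lemma reflK s : involutive (refl s).
Proof.
move=> u; apply/ffunP => t; rewrite !reflE pair_refl gram_diag.
by ring.
Qed.

Lemma refl_fix s u : pair s u = 0 -> refl s u = u.
Proof. by move=> u0; rewrite /cox_refl u0 scale0r subr0. Qed.

Lemma refl_simple s : refl s (alpha s) = - alpha s.
Proof.
by rewrite /cox_refl pair_simple gram_diag scaler_nat mulr2n opprD addNKr.
Qed.

Lemma refl_simple_edge s t : adj s t -> refl s (alpha t) = alpha s + alpha t.
Proof.
by move=> st; rewrite /cox_refl pair_simple gram_edge // scaleN1r opprK addrC.
Qed.

Lemma reflN s u : refl s (- u) = - refl s u.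
Proof. by rewrite /cox_refl pairN scaleNr opprD. Qed.

Lemma cox_reflE s u : refl s u = u - pair s u *: alpha s.
Proof. by []. Qed.

Lemma refl_comm s t u : s != t -> ~~ adj s t ->
  refl s (refl t u) = refl t (refl s u).
Proof.
move=> st e; apply/ffunP => r; rewrite !reflE !pair_refl.
rewrite (gram_nonedge st e) gram_nonedge 1?eq_sym // 1?cox_edge_sym //.
move: (pair s u) (pair t u) (u r : R) ((r == s)%:R : R) ((r == t)%:R : R) => a b c d f.
ring.
Qed.

(* [sts] is the reflection in the root [alpha s + alpha t]. *)
Lemma refl_sts s t u : adj s t ->
  refl s (refl t (refl s u)) = u - (pair s u + pair t u) *: (alpha s + alpha t).
Proof.
move=> st; have ts : adj t s by rewrite cox_edge_sym.
have p1 : pair t (refl s u) = pair s u + pair t u by rewrite pair_refl_edge // addrC.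
have p2 : pair s (refl t (refl s u)) = pair t u.
  by rewrite pair_refl_edge // p1 pair_refl_diag addKr.
rewrite cox_reflE p2 cox_reflE p1 cox_reflE.
rewrite [in RHS]scalerDr [(_ + _) *: alpha s]scalerDl.
by rewrite !opprD !addrA [RHS]addrAC.
Qed.

Lemma refl_braid s t u : adj s t ->
  refl s (refl t (refl s u)) = refl t (refl s (refl t u)).
Proof.
move=> st; have ts : adj t s by rewrite cox_edge_sym.
by rewrite (refl_sts u st) (refl_sts u ts) [alpha t + _]addrC [pair t u + _]addrC.
Qed.

(** An ascending path from a simple root, each step adding a positive multiple of a simple root.
    This makes nonnegativity of the coordinates immediate; that the length depends only on the root,
    and that all positive roots arise, is proved afterwards. *)
Inductive depth_root : nat -> root -> Prop :=
| DepthSimple s : depth_root 0 (alpha s)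
| DepthRefl n t u :
    depth_root n u -> pair t u < 0 -> depth_root n.+1 (refl t u).

Lemma depth_root_ge0 n u : depth_root n u -> forall s, 0 <= (u s : R).
Proof.
elim=> [s t|{}n t {}u _ IH tu s]; first by rewrite simple_rootE ler0n.
rewrite reflE subr_ge0 (le_trans _ (IH s)) //.
by rewrite mulr_le0_ge0 // ltW.
Qed.

Lemma depth_root_neg n u s : depth_root n u -> u != - alpha s.
Proof.
move=> /depth_root_ge0/(_ s); apply: contraTneq => ->.
by rewrite ffunE simple_rootE eqxx -ltNge oppr_lt0.
Qed.

Lemma simple_root_inj : injective alpha.
Proof.
move=> s t /ffunP/(_ s); rewrite !simple_rootE eqxx.
by case: eqVneq => // _ /eqP; rewrite oner_eq0.
Qed.

Lemma depth_root_refl_neq n s u : depth_root n u -> pair s u < 0 ->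
  refl s u != alpha s.
Proof.
move=> du _; apply: contra_neq (depth_root_neg s du) => e.
by rewrite -refl_simple -e reflK.
Qed.

(** A last step along [t] would make [<alpha_t, alpha_s>] positive, so [t = s]; but an upward step
    along [s] cannot end at [alpha s], since it would start at [- alpha s]. *)
Lemma depth_root_simple n u s : depth_root n u -> u = alpha s -> n = 0%N.
Proof.
case=> // {}n t {}u du tu e; have := depth_root_refl_neq du tu; rewrite e.
have : 0 < pair t (refl t u) by rewrite pair_refl gram_diag; lra.
rewrite e pair_simple gramE; case: eqVneq => [->|_]; first by rewrite eqxx.
by case: ifP => _; rewrite ?oppr_gt0 ?ltr10 ?ltxx.
Qed.

(* Write the root as [refl t u] with [u] of smaller depth: its orbit under the
   dihedral group of [s] and [t] is a square or a hexagon, and the descent along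
   [s] follows the other side of it. *)
Lemma depth_root_descent n s u : depth_root n u -> u != alpha s ->
  0 < pair s u -> exists2 m, n = m.+1 & depth_root m (refl s u).
Proof.
move=> du; elim/ltn_ind: n s u du => n IH s b db.
case: db IH => [t _|{}n t u du tu IH bs].
  have [->|ts] := eqVneq t s; first by rewrite eqxx.
  rewrite pair_simple gramE [s == t]eq_sym (negbTE ts).
  by case: ifP => _; rewrite ?oppr_gt0 ?ltr10 ?ltxx.
have [ts|ts] := eqVneq t s; first by rewrite -ts reflK; exists n.
have st : s != t by rewrite eq_sym.
have gtt := gram_diag t; have gss := gram_diag s.
case: (boolP (adj s t)) => [e|e]; last first.
  have gst := gram_nonedge st e.
  have gts : g t s = 0 by rewrite gram_nonedge // cox_edge_sym.
  rewrite pair_refl gst mulr0 subr0 => su.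
  have us : u != alpha s.
    by apply: contraTneq tu => ->; rewrite pair_simple gts ltxx.
  have [//|m -> dm] := IH n _ s u du us su.
  exists m.+1 => //; rewrite refl_comm //; constructor=> //.
  by rewrite pair_refl gts mulr0 subr0.
have e' : adj t s by rewrite cox_edge_sym.
have gst := gram_edge e; have gts := gram_edge e'.
rewrite pair_refl gst => sb.
have [us|us] := eqVneq u (alpha s).
  exists n => //; have -> : n = 0%N by exact: depth_root_simple du us.
  suff -> : refl s (refl t u) = alpha t by exact: DepthSimple.
  by rewrite us refl_simple_edge // addrC -refl_simple_edge // reflK.
have [//||k nk dsu] := IH n _ s u du us; first by lra.
have tsu : refl s u != alpha t.
  apply: contraTneq tu => /(congr1 (refl s)); rewrite reflK => ->.
  by rewrite -leNgt pair_refl !pair_simple gtt gst gts; lra.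
have [||j kj dtsu] := IH k _ t (refl s u) dsu tsu; first by rewrite nk.
  by rewrite pair_refl gts; lra.
exists n; first reflexivity.
(* The bottom of the hexagon is [t s u]; going up from it along [s] and then [t] arrives at [s t u],
   at depth [j + 2 = n]. *)
have -> : refl s (refl t u) = refl t (refl s (refl t (refl s u))).
  by rewrite -(refl_braid _ e) reflK.
rewrite nk kj; constructor; first constructor=> //.
  by rewrite !pair_refl gst gss gts; lra.
by rewrite !pair_refl gst gss gts gtt; lra.
Qed.

(** By the descent property, the last step of one path is also a descent for the other depth, so
    both can be shortened together. *)
Lemma depth_root_inj n m u : depth_root n u -> depth_root m u -> n = m.
Proof.
move=> du; elim: du m => [s m dm|{}n t {}u du IH tu m dm].
  by rewrite (depth_root_simple dm erefl).
have [] := depth_root_descent dm (depth_root_refl_neq du tu).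
  by rewrite pair_refl gram_diag; lra.
by move=> k ->; rewrite reflK => /IH->.
Qed.

Lemma depth_root_is_root n u : depth_root n u -> is_root M u.
Proof.
by elim=> [s|{}n t {}u _ [w [s ->]] _]; [exists [::], s|exists (t :: w), s].
Qed.

Lemma depth_root_refl n s u : depth_root n u -> u != alpha s ->
  exists m, depth_root m (refl s u).
Proof.
move=> du us; have [su|su|su] := ltrgt0P (pair s u).
- by have [m _ dm] := depth_root_descent du us su; exists m.
- by exists n.+1; constructor.
- by exists n; rewrite refl_fix.
Qed.

(** Every root has a depth up to sign, as [t] preserves the roots with a depth except [alpha t],
    whose sign it changes. If [- u] has a depth while [u] has nonnegative coordinates, then [u = 0],
    and undoing the word would give [alpha s = 0]. *)
Lemma pos_rootP u : is_pos_root M u <-> exists n, depth_root n u.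
Proof.
split=> [[[w [s us]] u0]|[n du]]; last first.
  by split; [apply: depth_root_is_root du|apply: depth_root_ge0 du].
have [[n du]|[n dn]] : (exists n, depth_root n u) \/ exists n, depth_root n (- u).
- rewrite us; elim: w {u0 us} => [|t w IH] /=; first by left; exists 0%N; constructor.
  have flip n (v : root) : depth_root n v ->
      (exists n, depth_root n (refl t v)) \/ exists n, depth_root n (- refl t v).
    move=> dv; have [->|vt] := eqVneq v (alpha t); last first.
      by left; apply: depth_root_refl dv vt.
    by right; exists 0%N; rewrite refl_simple opprK; constructor.
  case: IH => [[n /flip//]|[n /flip]]; rewrite reflN opprK; tauto.
- by exists n.
- exfalso; have u00 : u = 0; last first.
    have act0 (v : root) : cox_act M w v = 0 -> v = 0.
      elim: w {us} => //= t w IH e; apply: IH.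
      by apply: (can_inj (reflK t)); rewrite e refl_fix ?pair0.
    have : g s s = 0.
      by rewrite -pair_simple [X in cox_form _ _ X](act0 (alpha s)) ?pair0 // -us.
    by rewrite gram_diag; lra.
  apply/ffunP => t; rewrite ffunE; apply/eqP; rewrite eq_le u0 andbT.
  by have := depth_root_ge0 dn t; rewrite ffunE oppr_ge0.
Qed.

(** * The polynomials and the forms on the actual root system *)

Local Notation pairing := (fun s u => cox_form M (alpha s) u).
Local Notation e := (root_basis M).
Local Notation Y := ratfun_y.
Local Notation ofy := ratfun_of_y.
Local Notation module := (root_module R M).

Definition root_coef : nat -> root -> S -> {poly rat} := coef adj refl pairing.

Let edge_sym : symmetric adj := cox_edge_sym.
Let edge_neq s t : adj s t -> s != t := @cox_edge_neq s t.

Lemma no_triangleP r s t : adj r s -> adj r t -> adj s t -> False.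
Proof. by move=> rs rt st; apply: notriM; exists r, s, t. Qed.

Lemma refl_simpleC s t : adj s t -> refl s (alpha t) = refl t (alpha s).
Proof.
by move=> st; rewrite !(refl_simple_edge) 1?addrC // cox_edge_sym.
Qed.

Lemma depth_root_case n u : depth_root n u ->
  (exists s, u = alpha s) \/
  exists m t v, [/\ n = m.+1, u = refl t v, depth_root m v & pair t v < 0].
Proof. by case=> [s|m t v dv tv]; [left; exists s|right; exists m, t, v]. Qed.

Let simple_depth n s (d : depth_root n (alpha s)) : n = 0%N :=
  depth_root_simple d erefl.

Lemma root_coef_upward n : upward adj refl pairing depth_root n.
Proof.
exact: (@coef_upward _ _ _ adj g alpha refl pairing depth_root edge_sym edge_neq
  no_triangleP gram_diag (@gram_edge) (@gram_nonedge) pair_simple pair_refl reflK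
  refl_comm refl_braid refl_simpleC DepthRefl
  simple_depth (@depth_root_descent) n).
Qed.

Lemma root_coef_fork n u s t : depth_root n u -> adj s t ->
  pair s u = 0 -> pair t u = 0 -> root_coef n u s = root_coef n u t.
Proof.
exact: (@coef_fork _ _ _ adj g alpha refl pairing depth_root edge_sym edge_neq
  no_triangleP gram_diag (@gram_edge) (@gram_nonedge) pair_simple pair_refl reflK
  refl_comm refl_braid refl_simpleC DepthRefl
  simple_depth depth_root_case (@depth_root_descent) n u s t).
Qed.

Lemma root_square_ind (P : root -> Prop) s t : s != t -> ~~ adj s t ->
  P (alpha s) -> P (alpha t) ->
  (forall n u, depth_root n u -> pair s u <= 0 -> pair t u <= 0 ->
    [/\ P u, P (refl s u), P (refl t u) & P (refl s (refl t u))]) ->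
  forall n u, depth_root n u -> P u.
Proof.
exact: (@square_ind _ _ _ adj g alpha refl pairing depth_root edge_sym
  gram_diag (@gram_nonedge) pair_simple pair_refl reflK (@depth_root_descent) P s t).
Qed.

Lemma root_hexagon_ind (P : root -> Prop) s t : adj s t ->
  P (alpha s) -> P (alpha t) -> P (refl s (alpha t)) ->
  (forall n u, depth_root n u -> pair s u <= 0 -> pair t u <= 0 ->
    P u /\ [/\ P (refl s u), P (refl t u), P (refl s (refl t u)),
      P (refl t (refl s u)) & P (refl s (refl t (refl s u)))]) ->
  forall n u, depth_root n u -> P u.
Proof.
exact: (@hexagon_ind _ _ _ adj g alpha refl pairing depth_root edge_sym
  gram_diag (@gram_edge) pair_simple pair_refl reflK refl_braid refl_simpleC
  (@depth_root_descent) P s t).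
Qed.

Section Coefficients.
Variables (n : nat) (u : root) (s t : S).
Hypotheses (du : depth_root n u) (tu : pair t u < 0).

Lemma root_coef_nonedge : s != t -> ~~ adj s t ->
  root_coef n.+1 (refl t u) s = 'X * root_coef n u s.
Proof.
exact: (@up_nonedge _ _ _ adj g refl pairing depth_root 
  (@gram_nonedge) pair_refl reflK n u s t (root_coef_upward (n := n)) du tu).
Qed.

Lemma root_coef_lt0 : adj s t -> pair s u < 0 ->
  root_coef n.+1 (refl t u) s = 'X * root_coef n u s + root_coef n u t.
Proof.
exact: (@up_lt0 _ _ _ adj g refl pairing depth_root 
  edge_neq (@gram_edge) pair_refl n u s t (root_coef_upward (n := n)) du tu).
Qed.

Lemma root_coef_eq0 : adj s t -> pair s u = 0 ->
  root_coef n.+1 (refl t u) s = ('X - 1) * root_coef n u s + root_coef n u t.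
Proof.
exact: (@up_eq0 _ _ _ adj g refl pairing depth_root 
  edge_neq (@gram_edge) pair_refl n u s t (root_coef_upward (n := n)) du tu).
Qed.

Lemma root_coef_gt0 : adj s t -> 0 < pair s u -> pair s u + pair t u <= 0 ->
  root_coef n.+1 (refl t u) s = 'X * root_coef n.-1 (refl s u) t.
Proof.
exact: (@up_gt0 _ _ _ adj g refl pairing depth_root 
  edge_neq (@gram_edge) pair_refl n u s t (root_coef_upward (n := n)) du tu).
Qed.

End Coefficients.

Lemma root_coef_pos n u s : 0 < pair s u -> root_coef n u s = 0.
Proof. by apply: coef_gt0; exact: reflK. Qed.

Lemma root_coef_simple s t : s != t -> root_coef 0 (alpha t) s = 1.
Proof.
exact: (@coef_simple _ _ _ adj g alpha refl pairing (@gram_edge) (@gram_nonedge)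
  pair_simple s t).
Qed.

(* T(s, u), for a root [u] of depth [n]. *)
Definition root_poly (n : nat) (u : root) (s : S) : {poly rat} :=
  ('X - 1) * ('X^n - root_coef n u s) + (u == alpha s)%:R.

(** The default 0 is never met on a positive root, by [pos_rootP]. *)
Definition root_depth (u : root) : nat :=
  if pselect (exists n, depth_root n u) is left ex then sval (cid ex) else 0%N.

Lemma root_depthE n u : depth_root n u -> root_depth u = n.
Proof.
rewrite /root_depth => du; case: pselect => [ex|[]]; last by exists n.
exact: depth_root_inj (svalP (cid ex)) du.
Qed.

Definition lkp_poly (s : S) (b : pos_root R M) : {poly rat} :=
  root_poly (root_depth b) b s.

Definition lkp_form (s : S) : module -> ratfun2^o :=
  linear_extension (fun b => ofy (lkp_poly s b) : ratfun2^o).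

HB.instance Definition _ s := GRing.Linear.copy (lkp_form s)
  (linear_extension (fun b => ofy (lkp_poly s b) : ratfun2^o)).

Lemma depth_rootE n u : depth_root n u -> exists2 b : pos_root R M,
  u = b & e u = << b >>.
Proof.
move=> du; have pu : `[< is_pos_root M u >] by apply/asboolP/pos_rootP => //; exists n.
by exists (PosRoot pu); rewrite // -root_basisE.
Qed.

Lemma lkp_formE n u s : depth_root n u -> lkp_form s (e u) = ofy (root_poly n u s).
Proof.
move=> du; have [b ub ->] := depth_rootE du.
by rewrite /lkp_form linear_extension_basis /lkp_poly -ub (root_depthE du).
Qed.

Lemma phiE n u s : depth_root n u -> phi s (e u) =
  if u == alpha s then 0
  else if pair s u == 0 then e u
  else if 0 < pair s u then Y *: e (refl s u)
  else (1 - Y) *: e u + e (refl s u).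
Proof.
move=> du; have [b ub eb] := depth_rootE du.
rewrite eb /phi linear_extension_basis /phi_basis -ub eb cox_reflE.
by rewrite scaleNr.
Qed.

(** * The action on basis vectors, and invertibility *)

Lemma phi_simple s : phi s (e (alpha s)) = 0.
Proof. by rewrite (phiE _ (DepthSimple s)) eqxx. Qed.

Lemma phi_lt0 n u s : depth_root n u -> pair s u < 0 ->
  phi s (e u) = (1 - Y) *: e u + e (refl s u).
Proof.
move=> du su; rewrite (phiE _ du) (lt_eqF su) ltNge (ltW su) /=.
by case: eqP su => // ->; rewrite pair_simple gram_diag // ltrn0.
Qed.

Lemma phi_eq0 n u s : depth_root n u -> pair s u = 0 -> phi s (e u) = e u.
Proof.
move=> du su; rewrite (phiE _ du) su eqxx.
case: eqP su => // ->; rewrite pair_simple gram_diag // => /eqP.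
by rewrite pnatr_eq0.
Qed.

(* Upwards from [u], so that [refl s u] is not [alpha s]. *)
Lemma phi_refl n u s : depth_root n u -> pair s u < 0 ->
  phi s (e (refl s u)) = Y *: e u.
Proof.
move=> du su; rewrite (phiE _ (DepthRefl du su)) reflK //.
have su' : 0 < pair s (refl s u) by rewrite pair_refl gram_diag //; lra.
by rewrite (negbTE (depth_root_refl_neq du su)) (gt_eqF su') su'.
Qed.

Lemma psiE s v : psi lkp_poly s v =
  rank_one_deformation ratfun_x (phi s) (lkp_form s) (e (alpha s)) v.
Proof.
elim/root_module_ind: v => [|a u v IHu IHv|u /pos_rootP [n du]].
- by rewrite /rank_one_deformation !linear0 mulr0 scale0r addr0.
- have formP : lkp_form s (a *: u + v) = a * lkp_form s u + lkp_form s v.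
    exact: linearP.
  rewrite /rank_one_deformation formP in IHu IHv *.
  rewrite !linearP /= IHu IHv scalerDr scalerA mulrDr mulrCA scalerDl.
  exact: addrACA.
- have [b ub eb] := depth_rootE du.
  rewrite /psi eb linear_extension_basis /rank_one_deformation /lkp_form.
  by rewrite linear_extension_basis root_basisE.
Qed.

Lemma depth_neq_simple n u s : depth_root n.+1 u -> u != alpha s.
Proof. by move=> du; apply/eqP => us; have := depth_root_simple du us. Qed.

Lemma lkp_form_gen n u s : depth_root n u -> u != alpha s ->
  lkp_form s (e u) = (Y - 1) * (Y ^+ n - ofy (root_coef n u s)).
Proof.
move=> du /negbTE us; rewrite (lkp_formE _ du) /root_poly us addr0.
by rewrite ratfun_of_yM !ratfun_of_yB ratfun_of_yXn ratfun_of_y1.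
Qed.

Lemma lkp_form_pos n u s : depth_root n u -> u != alpha s -> 0 < pair s u ->
  lkp_form s (e u) = (Y - 1) * Y ^+ n.
Proof.
move=> du us su; rewrite (lkp_form_gen du us) (root_coef_pos _ su) ratfun_of_y0.
by rewrite [X in _ * X]subr0.
Qed.

Lemma lkp_form_simple s t : s != t -> lkp_form s (e (alpha t)) = 0.
Proof.
move=> st; rewrite (lkp_form_gen (DepthSimple t)); last first.
  by apply: contra_neq st => /simple_root_inj.
by rewrite root_coef_simple // ratfun_of_y1 expr0 subrr mulr0.
Qed.

Lemma lkp_form_diag s : lkp_form s (e (alpha s)) = Y.
Proof.
rewrite (lkp_formE _ (DepthSimple s)) /root_poly eqxx root_coef_pos.
  by rewrite subr0 expr0 mulr1 subrK.
by rewrite pair_simple gram_diag // ltr0n.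
Qed.

(** On the span of [e_u] and [e_{s u}] the map satisfies [(X - 1)(X + y) = 0]. The relation fails at
    [alpha s], where [phi s] gives 0. *)
Lemma phi_quadratic n u s : depth_root n u -> u != alpha s ->
  phi s (phi s (e u)) = (1 - Y) *: phi s (e u) + Y *: e u.
Proof.
move=> du us; have [su|su|su] := ltrgt0P (pair s u).
- have [m _ dv] := depth_root_descent du us su.
  have sv : pair s (refl s u) < 0 by rewrite pair_refl gram_diag //; lra.
  rewrite -[u](reflK s); move: (refl s u) dv sv => v dv sv.
  by rewrite (phi_refl dv sv) linearZ /= (phi_lt0 dv sv) scalerDr !scalerA mulrC.
- by rewrite (phi_lt0 du su) linearD linearZ /= (phi_lt0 du su) (phi_refl du su).
- by rewrite !(phi_eq0 du su) -scalerDl subrK scale1r.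
Qed.

(** The quadratic relation of [phi s] fails only along [e_{alpha_s}], which the form of [t] does not
    see. *)
Lemma lkp_form_quadratic s t v : s != t ->
  lkp_form t (phi s (phi s v)) = (1 - Y) * lkp_form t (phi s v) + Y * lkp_form t v.
Proof.
move=> st; elim/root_module_ind: v => [|a u v IHu IHv|u /pos_rootP [n du]].
- by rewrite !linear0 !mulr0 addr0.
- rewrite !linearP /= IHu IHv /GRing.scale /=; ring.
- have [->|us] := eqVneq u (alpha s).
    by rewrite phi_simple !linear0 lkp_form_simple 1?eq_sym // !mulr0 addr0.
  by rewrite (phi_quadratic du us) linearP linearZ.
Qed.

Lemma psi_simple s : psi lkp_poly s (e (alpha s)) = (ratfun_x * Y) *: e (alpha s).
Proof. by rewrite psiE /rank_one_deformation phi_simple add0r lkp_form_diag. Qed.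

Lemma psi_bijective s : bijective (psi lkp_poly s : module -> module).
Proof.
have xy0 : ratfun_x * Y != 0.
  by apply: mulf_neq0; [exact: ratfun_x_neq0|exact: ratfun_y_neq0].
apply: (bijective_of_defect (linearP _) xy0 ratfun_y_neq0 (psi_simple s)) => v.
pose P : {linear module -> module} := psi lkp_poly s.
(* As a linear map, the defect stays in the line of [e_{alpha_s}] as soon as it does so on basis
   vectors. *)
pose Q : {linear module -> module} := ((P \o P) \- ((1 - Y) \*: P)) \- (Y \*: idfun).
change (exists k, Q v = k *: e (alpha s)).
elim/root_module_ind: v => [|a u v [k Qu] [l Qv]|u /pos_rootP [n du]].
- by exists 0; rewrite linear0 scale0r.
- by exists (a * k + l); rewrite linearP Qu Qv scalerA scalerDl.
have [->|us] := eqVneq u (alpha s).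
  exists (ratfun_x * Y * (ratfun_x * Y) - (1 - Y) * (ratfun_x * Y) - Y).
  rewrite /Q /P /= psi_simple linearZ /= psi_simple !scalerA -!scalerBl.
  by [].
rewrite /Q /P /= !psiE; eexists.
apply: deformation_defect; first exact: phi_simple.
exact: phi_quadratic du us.
Qed.

Lemma neq_simple_lt0 s u : pair s u <= 0 -> u != alpha s.
Proof. by apply: contraTneq => ->; rewrite pair_simple gram_diag // -ltNge ltr0n. Qed.

Lemma pair_simple_edge s t : adj s t -> pair s (alpha t) < 0.
Proof. by move=> st; rewrite pair_simple gram_edge // oppr_lt0 ltr01. Qed.

Lemma phi_commute s t v : s != t -> ~~ adj s t ->
  phi s (phi t v) = phi t (phi s v) :> module.
Proof.
move=> st nst; elim/root_module_ind: v => [|a u v IHu IHv|u /pos_rootP [n du]].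
- by rewrite !linear0.
- by rewrite !linearP /= IHu IHv.
have ts : t != s by rewrite eq_sym.
have nts : ~~ adj t s by rewrite edge_sym.
move: n u du.
pose P (u : root) := phi s (phi t (e u)) = phi t (phi s (e u)).
apply: (@root_square_ind P s t st nst) => [||n u du].
- have ets : pair t (alpha s) = 0 by rewrite pair_simple gram_nonedge.
  by rewrite /P (phi_eq0 (DepthSimple s) ets) !phi_simple linear0.
- have est : pair s (alpha t) = 0 by rewrite pair_simple gram_nonedge.
  by rewrite /P (phi_eq0 (DepthSimple t) est) !phi_simple linear0.
have pst v : pair s (refl t v) = pair s v by exact: pair_refl_nonedge.
have pts v : pair t (refl s v) = pair t v by exact: pair_refl_nonedge.
(* A vanishing pairing collapses the square to two roots, or to one if both vanish. *)
rewrite !le_eqVlt => /predU1P[su|su] /predU1P[tu|tu].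
- rewrite !(refl_fix tu) (refl_fix su).
  suff Pu : P u by split.
  by rewrite /P (phi_eq0 du su) (phi_eq0 du tu) (phi_eq0 du su).
- have dtu := DepthRefl du tu.
  have stu : pair s (refl t u) = 0 by rewrite pst.
  rewrite (refl_fix su) (refl_fix stu).
  suff [Pu Ptu] : P u /\ P (refl t u) by split.
  split; rewrite /P.
    rewrite (phi_eq0 du su) (phi_lt0 du tu) linearD linearZ /=.
    by rewrite (phi_eq0 du su) (phi_eq0 dtu stu).
  by rewrite (phi_eq0 dtu stu) (phi_refl du tu) linearZ /= (phi_eq0 du su).
- have dsu := DepthRefl du su.
  have tsu : pair t (refl s u) = 0 by rewrite pts.
  rewrite (refl_comm u st nst) (refl_fix tu) (refl_fix tsu).
  suff [Pu Psu] : P u /\ P (refl s u) by split.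
  split; rewrite /P.
    rewrite (phi_eq0 du tu) (phi_lt0 du su) linearD linearZ /=.
    by rewrite (phi_eq0 du tu) (phi_eq0 dsu tsu).
  by rewrite (phi_eq0 dsu tsu) (phi_refl du su) linearZ /= (phi_eq0 du tu).
have dsu := DepthRefl du su; have dtu := DepthRefl du tu.
have stu : pair s (refl t u) < 0 by rewrite pst.
have tsu : pair t (refl s u) < 0 by rewrite pts.
have E4 := phi_lt0 dsu tsu; have E8 := phi_refl dsu tsu.
rewrite -(refl_comm u st nst) in E4 E8.
exact: (commute_regular (phi_lt0 du su) (phi_lt0 du tu) (phi_refl du su) E4
  (phi_refl du tu) (phi_lt0 dtu stu) (phi_refl dtu stu) E8).
Qed.

(** * Orbits of an edge and the braid relation for [phi] *)

Section Hexagon.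
Variables (s t : S) (n : nat) (u : root).
Hypotheses (st : adj s t) (du : depth_root n u) (su : pair s u < 0) (tu : pair t u < 0).

Lemma hexagon_pair :
  [/\ pair t (refl s u) < 0, pair s (refl t u) < 0,
    pair s (refl t (refl s u)) = pair t u & pair t (refl s (refl t u)) = pair s u].
Proof.
have ts : adj t s by rewrite edge_sym.
rewrite !(pair_refl_edge _ st, pair_refl_edge _ ts, pair_refl_diag).
move: su tu; move: (pair s u) (pair t u) => a b a0 b0.
by split; lra.
Qed.

Lemma phi_hexagon :
  let e_s := e (refl s u) in let e_t := e (refl t u) in
  let e_st := e (refl s (refl t u)) in let e_ts := e (refl t (refl s u)) in
  let e_sts := e (refl s (refl t (refl s u))) in
  [/\ [/\ phi s (e u) = (1 - Y) *: e u + e_s,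
       phi t (e u) = (1 - Y) *: e u + e_t,
       phi s e_s = Y *: e u, phi t e_s = (1 - Y) *: e_s + e_ts
     & phi t e_t = Y *: e u],
   [/\ phi s e_t = (1 - Y) *: e_t + e_st,
       phi s e_st = Y *: e_t, phi t e_st = (1 - Y) *: e_st + e_sts
     & phi t e_ts = Y *: e_s] &
   [/\ phi s e_ts = (1 - Y) *: e_ts + e_sts,
       phi s e_sts = Y *: e_ts & phi t e_sts = Y *: e_st]].
Proof.
have [tsu stu stsu tstu] := hexagon_pair.
have dsu := DepthRefl du su; have dtu := DepthRefl du tu.
have dts := DepthRefl dsu tsu; have dst := DepthRefl dtu stu.
have pst : pair s (refl t (refl s u)) < 0 by rewrite stsu.
have pts : pair t (refl s (refl t u)) < 0 by rewrite tstu.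
split; split.
- exact: phi_lt0 du su.
- exact: phi_lt0 du tu.
- exact: phi_refl du su.
- exact: phi_lt0 dsu tsu.
- exact: phi_refl du tu.
- exact: phi_lt0 dtu stu.
- exact: phi_refl dtu stu.
- by rewrite (refl_braid u st); exact: phi_lt0 dst pts.
- exact: phi_refl dsu tsu.
- exact: phi_lt0 dts pst.
- exact: phi_refl dts pst.
- by rewrite (refl_braid u st); exact: phi_refl dst pts.
Qed.

End Hexagon.

Section Wall.
Variables (s t : S) (n : nat) (u : root).
Hypotheses (st : adj s t) (du : depth_root n u) (su : pair s u = 0) (tu : pair t u < 0).

Lemma wall_pair : pair s (refl t u) = pair t u /\ pair t (refl s (refl t u)) = 0.
Proof.
have ts : adj t s by rewrite edge_sym.
by rewrite !(pair_refl_edge _ st, pair_refl_edge _ ts, pair_refl_diag) su add0r addNr.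
Qed.

Lemma phi_wall :
  let e_t := e (refl t u) in let e_st := e (refl s (refl t u)) in
  [/\ phi s (e u) = e u, phi t (e u) = (1 - Y) *: e u + e_t
     & phi t e_t = Y *: e u] /\
   [/\ phi s e_t = (1 - Y) *: e_t + e_st, phi s e_st = Y *: e_t
     & phi t e_st = e_st].
Proof.
have [stu tstu] := wall_pair; have dtu := DepthRefl du tu.
have stu0 : pair s (refl t u) < 0 by rewrite stu.
have dst := DepthRefl dtu stu0.
split; split.
- exact: phi_eq0 du su.
- exact: phi_lt0 du tu.
- exact: phi_refl du tu.
- exact: phi_lt0 dtu stu0.
- exact: phi_refl dtu stu0.
- exact: phi_eq0 dst tstu.
Qed.

End Wall.

Lemma phi_braid s t v : adj s t ->
  phi s (phi t (phi s v)) = phi t (phi s (phi t v)) :> module.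
Proof.
move=> st; have ts : adj t s by rewrite edge_sym.
elim/root_module_ind: v => [|a u v IHu IHv|u /pos_rootP [n du]].
- by rewrite !linear0.
- by rewrite !linearP /= IHu IHv.
move: n u du.
pose P (u : root) := phi s (phi t (phi s (e u))) = phi t (phi s (phi t (e u))).
have [Ps Pt Pst] : [/\ P (alpha s), P (alpha t) & P (refl s (alpha t))].
  have dt := DepthSimple t; have ds := DepthSimple s.
  have pst := pair_simple_edge st; have pts := pair_simple_edge ts.
  have E4 := phi_lt0 ds pts; have E6 := phi_refl ds pts.
  rewrite (refl_simpleC ts) in E4 E6.
  exact: (braid_simple (phi_simple s) (phi_simple t) (phi_lt0 dt pst) E4
    (phi_refl dt pst) E6).
apply: (@root_hexagon_ind P s t st Ps Pt Pst) => n u du.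
(* The hexagon collapses to one root if both pairings vanish and to three if exactly one does;
   repeated entries below reflect this. *)
rewrite !le_eqVlt => /predU1P[su|su] /predU1P[tu|tu].
- rewrite !(refl_fix su, refl_fix tu).
  suff Pu : P u by exact: (conj Pu (And5 Pu Pu Pu Pu Pu)).
  by rewrite /P !(phi_eq0 du su, phi_eq0 du tu).
- have [[E1 E2 E3] [E4 E5 E6]] := phi_wall st du su tu.
  have [P1 P2 P3] := braid_wall E1 E2 E3 E4 E5 E6.
  by rewrite !(refl_fix su); exact: (conj P1 (And5 P1 P2 P3 P2 P3)).
- have [[E1 E2 E3] [E4 E5 E6]] := phi_wall ts du tu su.
  have [/esym P1 /esym P2 /esym P3] := braid_wall E1 E2 E3 E4 E5 E6.
  rewrite (refl_braid u st) !(refl_fix tu).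
  exact: (conj P1 (And5 P2 P1 P2 P3 P3)).
have [[E1 E2 E3 E4 E5] [E6 E7 E8 E9] [E10 E11 E12]] := phi_hexagon st du su tu.
exact: (braid_regular E1 E2 E3 E4 E5 E6 E7 E8 E9 E10 E11 E12).
Qed.

(** * The conditions on the linear forms *)

Lemma lkp_form_depth k n u s c : depth_root (k.+1 + n) u ->
  root_coef (k.+1 + n) u s = c ->
  lkp_form s (e u) = (Y - 1) * (Y ^+ k.+1 * Y ^+ n - ofy c).
Proof.
by move=> du <-; rewrite (lkp_form_gen du (depth_neq_simple s du)) exprD.
Qed.

Lemma lkp_form_depth_pos k n u s : depth_root (k.+1 + n) u ->
  0 < pair s u -> lkp_form s (e u) = (Y - 1) * (Y ^+ k.+1 * Y ^+ n).
Proof.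
by move=> du su; rewrite (lkp_form_pos du (depth_neq_simple s du) su) exprD.
Qed.

Lemma lkp_form_nonedge s t v : s != t -> ~~ adj s t ->
  lkp_form s (phi t v) = lkp_form s v.
Proof.
move=> st nst; elim/root_module_ind: v => [|a u v IHu IHv|u /pos_rootP [n du]].
- by rewrite !linear0.
- by rewrite !linearP /= IHu IHv.
(* Going up along [t] multiplies both [y^d] and [N_s] by [y]. *)
have up m w : depth_root m w -> pair t w < 0 ->
    lkp_form s (e (refl t w)) = Y * lkp_form s (e w).
  move=> dw tw; have ws : w != alpha s.
    apply: contraTneq tw => ->.
    by rewrite pair_simple gram_nonedge 1?eq_sym 1?cox_edge_sym // ltxx.
  have dtw := DepthRefl dw tw.
  rewrite (lkp_form_gen dtw (depth_neq_simple s dtw)) (lkp_form_gen dw ws).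
  by rewrite (root_coef_nonedge dw tw st nst) ratfun_of_yM exprS -mulrBr mulrCA.
have [->|ut] := eqVneq u (alpha t).
  by rewrite phi_simple linear0 lkp_form_simple.
have [tu|tu|tu] := ltrgt0P (pair t u).
- have [m _ dv] := depth_root_descent du ut tu.
  have tv : pair t (refl t u) < 0 by rewrite pair_refl_diag oppr_lt0.
  rewrite -[u](reflK t); move: (refl t u) dv tv => v dv tv.
  by rewrite (phi_refl dv tv) linearZ /= (up _ _ dv tv).
- rewrite (phi_lt0 du tu) linearD linearZ /= (up _ _ du tu).
  by rewrite -[_ *: _]/(_ * _) -mulrDl subrK mul1r.
- by rewrite (phi_eq0 du tu).
Qed.

(** The form is [y] at [alpha_s] and [(y - 1) y] at [alpha_s + alpha_t], and
    [(1 - y) y + (y - 1) y = 0]. It has to vanish because [phi s] kills [e_{alpha_s}] on the other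
    side of the edge condition. *)
Lemma lkp_form_agree_simple s t : adj s t -> lkp_form s (phi t (e (alpha s))) = 0.
Proof.
move=> st; have ts : adj t s by rewrite edge_sym.
have ds := DepthSimple s; have pts := pair_simple_edge ts.
rewrite (phi_lt0 ds pts) linearD linearZ /= lkp_form_diag.
have dts := DepthRefl ds pts.
rewrite (lkp_form_pos dts (depth_neq_simple s dts)); last first.
  by rewrite pair_refl_edge // !pair_simple gram_diag gram_edge //; lra.
by rewrite -mulrDl addrA subrK subrr mul0r.
Qed.

Lemma lkp_form_agree s t v : adj s t -> lkp_form s (phi t v) = lkp_form t (phi s v).
Proof.
move=> st; have ts : adj t s by rewrite edge_sym.
elim/root_module_ind: v => [|a u v IHu IHv|u /pos_rootP [n du]].
- by rewrite !linear0.
- by rewrite !linearP /= IHu IHv.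
move: n u du.
pose P (u : root) := lkp_form s (phi t (e u)) = lkp_form t (phi s (e u)).
have Ps : P (alpha s) by rewrite /P phi_simple linear0 lkp_form_agree_simple.
have Pt : P (alpha t) by rewrite /P phi_simple linear0 lkp_form_agree_simple.
have Pst : P (refl s (alpha t)).
  rewrite /P (phi_refl (DepthSimple t) (pair_simple_edge st)).
  rewrite (refl_simpleC st) (phi_refl (DepthSimple s) (pair_simple_edge ts)).
  by rewrite !linearZ /= !lkp_form_diag.
have diag q w : pair q w < 0 -> 0 < pair q (refl q w).
  by rewrite pair_refl_diag oppr_gt0.
have wall s' t' n u : adj s' t' -> depth_root n u -> pair s' u = 0 -> pair t' u < 0 ->
    let Q u := lkp_form s' (phi t' (e u)) = lkp_form t' (phi s' (e u)) in
    [/\ Q u, Q (refl t' u) & Q (refl s' (refl t' u))].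
  move=> st' du su tu Q; have ts' : adj t' s' by rewrite edge_sym.
  have [[E1 E2 E3] [E4 E5 E6]] := phi_wall st' du su tu.
  have [stu tstu] := wall_pair st' su.
  have dtu := DepthRefl du tu.
  have stu0 : pair s' (refl t' u) < 0 by rewrite stu.
  have dst := DepthRefl dtu stu0.
  have us : u != alpha s' by apply: neq_simple_lt0; rewrite su.
  have ut : u != alpha t' by apply: neq_simple_lt0; rewrite ltW.
  set a := ofy (root_coef n u s'); set b := ofy (root_coef n u t').
  have F1 := lkp_form_gen du us; have F2 := lkp_form_gen du ut.
  have F3 := lkp_form_depth_pos (k := 0) dtu (diag _ _ tu).
  have F4 : lkp_form s' (e (refl t' u)) =
      (Y - 1) * (Y * Y ^+ n - ((Y - 1) * a + b)).
    rewrite (lkp_form_depth (k := 0) dtu (root_coef_eq0 du tu st' su)).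
    by rewrite ratfun_of_yD ratfun_of_yM ratfun_of_yB ratfun_of_y1 expr1.
  have F5 := lkp_form_depth_pos (k := 1) dst (diag _ _ stu0).
  have F6 : lkp_form t' (e (refl s' (refl t' u))) =
      (Y - 1) * (Y ^+ 2 * Y ^+ n - Y * a).
    have le0 : pair t' (refl t' u) + pair s' (refl t' u) <= 0.
      by rewrite pair_refl_diag stu addNr.
    have := root_coef_gt0 dtu stu0 ts' (diag _ _ tu) le0.
    by rewrite reflK => /(lkp_form_depth (k := 1) dst); rewrite ratfun_of_yM.
  exact: (agree_wall E1 E2 E3 E4 E5 E6 F1 F2 F3 F4 F5 F6).
apply: (@root_hexagon_ind P s t st Ps Pt Pst) => n u du.
rewrite !le_eqVlt => /predU1P[su|su] /predU1P[tu|tu].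
- rewrite !(refl_fix su, refl_fix tu).
  suff Pu : P u by exact: (conj Pu (And5 Pu Pu Pu Pu Pu)).
  (* With both pairings zero only [T_s(e_u) = T_t(e_u)] is left, which is [root_coef_fork]. *)
  rewrite /P !(phi_eq0 du su, phi_eq0 du tu).
  have us : u != alpha s by apply: neq_simple_lt0; rewrite su.
  have ut : u != alpha t by apply: neq_simple_lt0; rewrite tu.
  by rewrite (lkp_form_gen du us) (lkp_form_gen du ut) (root_coef_fork du st su tu).
- have [P1 P2 P3] := wall s t n u st du su tu.
  by rewrite !(refl_fix su); exact: (conj P1 (And5 P1 P2 P3 P2 P3)).
- have [/esym P1 /esym P2 /esym P3] := wall t s n u ts du tu su.
  rewrite (refl_braid u st) !(refl_fix tu).
  exact: (conj P1 (And5 P2 P1 P2 P3 P3)).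
have [[E1 E2 E3 E4 E5] [E6 E7 E8 E9] [E10 E11 E12]] := phi_hexagon st du su tu.
have [tsu stu stsu tstu] := hexagon_pair st su tu.
have dsu := DepthRefl du su; have dtu := DepthRefl du tu.
have dts := DepthRefl dsu tsu; have dst := DepthRefl dtu stu.
have pst : pair s (refl t (refl s u)) < 0 by rewrite stsu.
have dsts := DepthRefl dts pst.
have us : u != alpha s by apply: neq_simple_lt0; rewrite ltW.
have ut : u != alpha t by apply: neq_simple_lt0; rewrite ltW.
set a := ofy (root_coef n u s); set b := ofy (root_coef n u t).
have F1 := lkp_form_gen du us; have F2 := lkp_form_gen du ut.
have F3 := lkp_form_depth_pos (k := 0) dsu (diag _ _ su).
have F4 : lkp_form t (e (refl s u)) = (Y - 1) * (Y * Y ^+ n - (Y * b + a)).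
  rewrite (lkp_form_depth (k := 0) dsu (root_coef_lt0 du su ts tu)).
  by rewrite ratfun_of_yD ratfun_of_yM expr1.
have F5 := lkp_form_depth_pos (k := 0) dtu (diag _ _ tu).
have F6 : lkp_form s (e (refl t u)) = (Y - 1) * (Y * Y ^+ n - (Y * a + b)).
  rewrite (lkp_form_depth (k := 0) dtu (root_coef_lt0 du tu st su)).
  by rewrite ratfun_of_yD ratfun_of_yM expr1.
have F7 := lkp_form_depth_pos (k := 1) dst (diag _ _ stu).
(* The rule for a positive pairing applies [t] to [t u], so the value at [s t u] comes from [a] at
   the bottom. *)
have F8 : lkp_form t (e (refl s (refl t u))) = (Y - 1) * (Y ^+ 2 * Y ^+ n - Y * a).
  have le0 : pair t (refl t u) + pair s (refl t u) <= 0.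
    by rewrite pair_refl_diag (pair_refl_edge u st) addrC addrK ltW.
  have := root_coef_gt0 dtu stu ts (diag _ _ tu) le0.
  by rewrite reflK => /(lkp_form_depth (k := 1) dst); rewrite ratfun_of_yM.
have F9 := lkp_form_depth_pos (k := 1) dts (diag _ _ tsu).
have F10 : lkp_form s (e (refl t (refl s u))) = (Y - 1) * (Y ^+ 2 * Y ^+ n - Y * b).
  have le0 : pair s (refl s u) + pair t (refl s u) <= 0.
    by rewrite pair_refl_diag (pair_refl_edge u ts) addrC addrK ltW.
  have := root_coef_gt0 dsu tsu st (diag _ _ su) le0.
  by rewrite reflK => /(lkp_form_depth (k := 1) dts); rewrite ratfun_of_yM.
have F11 := lkp_form_depth_pos (k := 2) dsts (diag _ _ pst).
have top : 0 < pair t (refl s (refl t (refl s u))).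
  by rewrite (refl_braid u st); apply: diag; rewrite tstu.
have F12 := lkp_form_depth_pos (k := 2) dsts top.
exact: (agree_regular E1 E2 E3 E4 E5 E6 E7 E8 E9 E10 E11 E12
  F1 F2 F3 F4 F5 F6 F7 F8 F9 F10 F11 F12).
Qed.

(** * The Artin relations and the homomorphism *)

Lemma psi_commute s t v : s != t -> ~~ adj s t ->
  psi lkp_poly s (psi lkp_poly t v) = psi lkp_poly t (psi lkp_poly s v) :> module.
Proof.
move=> st nst; have ts : t != s by rewrite eq_sym.
have nts : ~~ adj t s by rewrite edge_sym.
have pst : pair s (alpha t) = 0 by rewrite pair_simple gram_nonedge.
have pts : pair t (alpha s) = 0 by rewrite pair_simple gram_nonedge.
rewrite (psiE s (psi _ t v)) (psiE t v) (psiE t (psi _ s v)) (psiE s v).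
exact: (deformation_comm _ (phi_commute v st nst) (phi_eq0 (DepthSimple t) pst)
  (phi_eq0 (DepthSimple s) pts) (lkp_form_nonedge v st nst)
  (lkp_form_nonedge v ts nts) (lkp_form_simple st) (lkp_form_simple ts)).
Qed.

Lemma psi_braid s t v : adj s t ->
  psi lkp_poly s (psi lkp_poly t (psi lkp_poly s v)) =
  psi lkp_poly t (psi lkp_poly s (psi lkp_poly t v)) :> module.
Proof.
move=> st; have ts : adj t s by rewrite edge_sym.
have nst := cox_edge_neq st; have nts := cox_edge_neq ts.
have pst := pair_simple_edge st; have pts := pair_simple_edge ts.
have ds := DepthSimple s; have dt := DepthSimple t.
have E4 := phi_lt0 ds pts; have E6 := phi_refl ds pts.
rewrite (refl_simpleC ts) in E4 E6.
rewrite (psiE s (psi _ t _)) (psiE t (psi _ s v)) (psiE s v).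
rewrite (psiE t (psi _ s _)) (psiE s (psi _ t v)) (psiE t v).
exact: (deformation_braid _ (phi_braid v st) (phi_simple s) (phi_simple t)
  (phi_lt0 dt pst) E4 (phi_refl dt pst) E6 (fun w => lkp_form_agree w st)
  (lkp_form_simple nst) (lkp_form_simple nts) (lkp_form_quadratic v nst)
  (lkp_form_quadratic v nts)).
Qed.

Definition psi_gl (s : S) : general_linear module :=
  GeneralLinear (linearP (psi lkp_poly s)) (psi_bijective s).

Lemma artin_representation :
  exists Psi : UMagmaMorphism.type (artin_monoid M) (general_linear module),
    forall s v, Psi (artin_gen M s) v = psi lkp_poly s v.
Proof.
have [u v uv|Psi PsiE] := @presented_universal S (artin_rel M)
  (general_linear module) psi_gl; last by exists Psi => s v; rewrite PsiE.
case: uv => [s t mst|s t mst]; apply: gl_ext => w /=.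
  have st : s != t by apply/eqP => e; move: mst; rewrite e cox_diag.
  by apply: psi_commute => //; rewrite /cox_edge mst.
by apply: psi_braid; rewrite /cox_edge mst.
Qed.

End Roots.

Theorem theorem3p2 (R : realType) (S : finType) (M : coxeter_matrix S) :
  small_type M -> no_triangle M ->
  exists (T : S -> pos_root R M -> {poly rat})
    (Psi : UMagmaMorphism.type
             (artin_monoid M) (general_linear (root_module R M))),
    forall s v, Psi (artin_gen M s) v = psi T s v.
Proof.
move=> smallM notriM; exists (@lkp_poly R S M).
exact: artin_representation.
Qed.
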